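(* The Bardeen spacetime with parameters $M\neq0$, $e\ne0$ is not an Einstein manifold, but (i) it is an Einstein manifold of level $2$, i.e. there are smooth functions $\beta_3,\beta_4,\beta_5$ with $\beta_3\neq0$ such that $\beta_3S^2+\beta_4S+\beta_5g=0$; and (ii) it satisfies the Roter type condition, i.e. there are smooth functions $a_1,a_2,a_3$ such that $R=a_1\,g\wedge g+a_2\,g\wedge S+a_3\,S\wedge S$.
   Context: Bardeen spacetime: the $4$-dimensional semi-Riemannian manifold with coordinates $(t,\rho,\theta,\phi)$, $\rho>0$, $0<\theta<\pi$, on the region where $\rho_1^3\ne 2M\rho^2$, with $\rho_1=(e^2+\rho^2)^{1/2}$ and metric $$g=-\Big(1-\tfrac{2M\rho^2}{\rho_1^3}\Big)dt^2+\Big(1-\tfrac{2M\rho^2}{\rho_1^3}\Big)^{-1}d\rho^2+\rho^2(d\theta^2+\sin^2\theta\,d\phi^2).$$ $\nabla$ is the Levi-Civita connection; $R(\zeta_1,\zeta_2,\zeta_3,\zeta_4)=g(\nabla_{\zeta_1}\nabla_{\zeta_2}\zeta_3-\nabla_{\zeta_2}\nabla_{\zeta_1}\zeta_3-\nabla_{[\zeta_1,\zeta_2]}\zeta_3,\zeta_4)$ is the Riemann tensor and $S$ the Ricci tensor, with Ricci operator $\mathscr J$ given by $g(\zeta_1,\mathscr J\zeta_2)=S(\zeta_1,\zeta_2)$ and $S^2(X,Y)=S(\mathscr JX,Y)$. A manifold is Einstein if $S=\alpha g$ for some function $\alpha$. Kulkarni–Nomizu product of symmetric $(0,2)$-tensors: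 $(\tau\wedge\lambda)(\zeta_1,\zeta_2,X,Y)=\tau(\zeta_1,Y)\lambda(\zeta_2,X)-\tau(\zeta_1,X)\lambda(\zeta_2,Y)+\tau(\zeta_2,X)\lambda(\zeta_1,Y)-\tau(\zeta_2,Y)\lambda(\zeta_1,X)$. *)

(* Defs.v *)
From HB Require Import structures.
From mathcomp Require Import all_boot all_order all_algebra.
From mathcomp Require Import all_classical all_reals all_analysis.
From mathcomp Require Import ring.

Set Implicit Arguments.
Unset Strict Implicit.
Unset Printing Implicit Defensive.

Import Order.TTheory GRing.Theory Num.Theory.
Import numFieldNormedType.Exports.

Local Open Scope classical_set_scope.
Local Open Scope ring_scope.

(* Tensor calculus on an open set U of R^(n+1), in the standard coordinates.
   Scalar fields, vector fields and metrics are total functions, of which only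
   the values on U matter. *)
Notation rspace R n := 'rV[R]_n.+1 (only parsing).
Notation sfield R n := ('rV[R]_n.+1 -> R) (only parsing).
Notation vfield R n := ('rV[R]_n.+1 -> 'rV[R]_n.+1) (only parsing).
Notation mfield R n := ('rV[R]_n.+1 -> 'M[R]_n.+1) (only parsing).

Section Chart.
Variables (R : realType) (n : nat).
Local Notation rspace := (rspace R n).
Local Notation sfield := (sfield R n).
Local Notation vfield := (vfield R n).
Local Notation mfield := (mfield R n).

Definition ebase (i : 'I_n.+1) : 'rV[R]_n.+1 := delta_mx 0 i.
Definition partial (i : 'I_n.+1) (f : sfield) : sfield :=
  fun p => 'D_(ebase i) f p.

Fixpoint Ck_on (U : set rspace) (k : nat) (f : sfield) : Prop :=
  (forall p, U p -> {for p, continuous f}) /\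
  if k is k'.+1 then
    forall i, (forall p, U p -> derivable f p (ebase i)) /\
              Ck_on U k' (partial i f)
  else True.

Definition smooth_on (U : set rspace) (f : sfield) := forall k, Ck_on U k f.

Definition smooth_vf (U : set rspace) (X : vfield) :=
  forall i, smooth_on U (fun p => X p 0 i).

Definition coord_vf (i : 'I_n.+1) : vfield := fun=> ebase i.

Definition lie (X : vfield) (f : sfield) : sfield :=
  fun p => \sum_i X p 0 i * partial i f p.

Definition bracket (X Y : vfield) : vfield := fun p =>
  \row_k (lie X (fun q => Y q 0 k) p - lie Y (fun q => X q 0 k) p).

Definition metric (g : mfield) (X Y : vfield) : sfield :=
  fun p => (X p *m g p *m (Y p)^T) 0 0.

Record is_connection (U : set rspace) (nabla : vfield -> vfield -> vfield) :
    Prop := IsConnection {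
  conn_smooth : forall X Y, smooth_vf U X -> smooth_vf U Y ->
    smooth_vf U (nabla X Y);
  conn_addl : forall X X' Y, smooth_vf U X -> smooth_vf U X' ->
    smooth_vf U Y -> forall p, U p ->
    nabla (fun q => X q + X' q) Y p = nabla X Y p + nabla X' Y p;
  conn_scalel : forall f X Y, smooth_on U f -> smooth_vf U X ->
    smooth_vf U Y -> forall p, U p ->
    nabla (fun q => f q *: X q) Y p = f p *: nabla X Y p;
  conn_addr : forall X Y Y', smooth_vf U X -> smooth_vf U Y ->
    smooth_vf U Y' -> forall p, U p ->
    nabla X (fun q => Y q + Y' q) p = nabla X Y p + nabla X Y' p;
  conn_leibniz : forall f X Y, smooth_on U f -> smooth_vf U X ->
    smooth_vf U Y -> forall p, U p ->
    nabla X (fun q => f q *: Y q) p = lie X f p *: Y p + f p *: nabla X Y p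
}.

Record levi_civita (U : set rspace) (g : mfield)
    (nabla : vfield -> vfield -> vfield) : Prop := LeviCivita {
  lc_connection : is_connection U nabla;
  lc_torsion_free : forall X Y, smooth_vf U X -> smooth_vf U Y ->
    forall p, U p -> nabla X Y p - nabla Y X p = bracket X Y p;
  lc_metric : forall X Y Z, smooth_vf U X -> smooth_vf U Y ->
    smooth_vf U Z -> forall p, U p ->
    lie X (metric g Y Z) p =
    metric g (nabla X Y) Z p + metric g Y (nabla X Z) p
}.

Definition curvature (nabla : vfield -> vfield -> vfield) (X Y Z : vfield) :
    vfield := fun p =>
  nabla X (nabla Y Z) p - nabla Y (nabla X Z) p - nabla (bracket X Y) Z p.

Definition tensor2 := vfield -> vfield -> sfield.
Definition tensor4 := vfield -> vfield -> vfield -> vfield -> sfield.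

Definition riemann (g : mfield) nabla : tensor4 :=
  fun X1 X2 X3 X4 => metric g (curvature nabla X1 X2 X3) X4.

(* S(X,Y) is the trace of Z |-> R(Z,X)Y, taken in the coordinate frame. *)
Definition ricci nabla : tensor2 := fun X Y p =>
  \sum_k curvature nabla (coord_vf k) X Y p 0 k.

Record ricci_operator (U : set rspace) (g : mfield) nabla
    (J : vfield -> vfield) : Prop := RicciOperator {
  ricci_op_smooth : forall X, smooth_vf U X -> smooth_vf U (J X);
  ricci_opP : forall X Y, smooth_vf U X -> smooth_vf U Y ->
    forall p, U p -> metric g X (J Y) p = ricci nabla X Y p
}.

Definition ricci2 nabla (J : vfield -> vfield) : tensor2 :=
  fun X Y => ricci nabla (J X) Y.

Definition kulkarni_nomizu (tau lambda : tensor2) : tensor4 :=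
  fun X1 X2 X Y p =>
    tau X1 Y p * lambda X2 X p - tau X1 X p * lambda X2 Y p
    + tau X2 X p * lambda X1 Y p - tau X2 Y p * lambda X1 X p.

Definition einstein (U : set rspace) (g : mfield) nabla : Prop :=
  exists alpha : sfield, forall X Y, smooth_vf U X -> smooth_vf U Y ->
    forall p, U p -> ricci nabla X Y p = alpha p * metric g X Y p.

Definition einstein_level2 (U : set rspace) (g : mfield) nabla J : Prop :=
  exists b3 b4 b5 : sfield,
    [/\ smooth_on U b3, smooth_on U b4, smooth_on U b5,
        forall p, U p -> b3 p != 0 &
        forall X Y, smooth_vf U X -> smooth_vf U Y -> forall p, U p ->
          b3 p * ricci2 nabla J X Y p + b4 p * ricci nabla X Y p
          + b5 p * metric g X Y p = 0].

Definition roter_type (U : set rspace) (g : mfield) nabla : Prop :=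
  exists a1 a2 a3 : sfield,
    [/\ smooth_on U a1, smooth_on U a2, smooth_on U a3 &
        forall X1 X2 X3 X4, smooth_vf U X1 -> smooth_vf U X2 ->
          smooth_vf U X3 -> smooth_vf U X4 -> forall p, U p ->
          riemann g nabla X1 X2 X3 X4 p =
            a1 p * kulkarni_nomizu (metric g) (metric g) X1 X2 X3 X4 p
          + a2 p * kulkarni_nomizu (metric g) (ricci nabla) X1 X2 X3 X4 p
          + a3 p * kulkarni_nomizu (ricci nabla) (ricci nabla) X1 X2 X3 X4 p].

End Chart.

(* The coordinates (t, rho, theta, phi) of p : 'rV_4 are p 0 0, ..., p 0 3. *)
Section Bardeen.
Variables (R : realType) (M e : R).

Definition rho1 (rho : R) : R := Num.sqrt (e ^+ 2 + rho ^+ 2).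

Definition bardeen_f (rho : R) : R := 1 - 2 * M * rho ^+ 2 / rho1 rho ^+ 3.

(* t and phi range over all of R. *)
Definition bardeen_dom : set (rspace R 3) :=
  [set p | let rho := p 0 1 in let theta := p 0 2 in
    [/\ 0 < rho, 0 < theta < pi & rho1 rho ^+ 3 != 2 * M * rho ^+ 2]].

Definition bardeen_metric : mfield R 3 := fun p =>
  let rho := p 0 1 in let theta := p 0 2 in
  diag_mx (\row_(i < 4) [:: - bardeen_f rho; (bardeen_f rho)^-1; rho ^+ 2;
                            rho ^+ 2 * sin theta ^+ 2]`_i).

End Bardeen.

(* The hypotheses levi_civita and ricci_operator are satisfiable for the
   Bardeen metric (bardeen_levi_civita_exists): the witness is the connection
   given by the Christoffel symbols. *)
Section Smooth.
Variables (R : realType) (n : nat) (U : set (rspace R n)).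
Hypothesis oU : open U.
Implicit Types f g : sfield R n.
Local Notation eb := (@ebase R n).

Lemma eb_neq0 i : eb i != 0.
Proof.
apply/eqP => /(congr1 (fun v : 'rV[R]_n.+1 => v 0 i)).
by rewrite !mxE !eqxx => /eqP; rewrite oner_eq0.
Qed.

Lemma near_U f g p : U p -> (forall q, U q -> f q = g q) ->
  {near p, f =1 g}.
Proof. by move=> Up fg; move: (open_nbhs_nbhs (conj oU Up)); apply: filterS. Qed.

Lemma partial_ext i f g p : U p -> (forall q, U q -> f q = g q) ->
  partial i f p = partial i g p.
Proof. by move=> Up fg; apply: near_eq_derive; apply: near_U. Qed.

Lemma derivable_ext i f g p : U p -> (forall q, U q -> f q = g q) ->
  derivable f p (eb i) -> derivable g p (eb i).
Proof. by move=> Up fg; apply: near_eq_derivable; apply: near_U. Qed.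

Lemma cont_ext f g p : (forall q, U q -> f q = g q) -> U p ->
  {for p, continuous f} -> {for p, continuous g}.
Proof.
move=> fg Up cf; change (g x @[x --> p] --> g p); rewrite -(fg p Up).
have H : \forall x \near p, f x = g x by apply: near_U.
by apply: cvg_trans cf; apply: (@near_eq_cvg _ _ (nbhs p)).
Qed.

Lemma Ck_ext k f g : (forall q, U q -> f q = g q) ->
  Ck_on U k f -> Ck_on U k g.
Proof.
elim: k f g => [|k IH] f g fg [cf df]; split => //;
  try by move=> p Up; apply: (cont_ext fg Up); apply: cf.
move=> i; have [dfi Cfi] := df i; split.
  by move=> p Up; apply: (derivable_ext Up fg); apply: dfi.
by apply: IH Cfi => q Uq; apply: partial_ext.
Qed.

Lemma Ck_cont k f p : Ck_on U k f -> U p -> {for p, continuous f}.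
Proof. by case: k => [|k] [cf _] Up; exact: cf. Qed.

Lemma CkW k f : Ck_on U k.+1 f -> Ck_on U k f.
Proof.
elim: k f => [|k IH] f /= [cf df]; split => // i.
by have [dfi Cfi] := df i; split => //; apply: IH.
Qed.

Lemma Ck_cst k c : Ck_on U k (fun=> c).
Proof.
elim: k c => [|k IH] c; split => //; try by move=> p _; apply: cst_continuous.
move=> i; split; first by move=> p _; exact: derivable_cst.
by apply: Ck_ext (IH 0) => q _; rewrite /partial (derive_cst c).
Qed.

Lemma Ck_add k f g : Ck_on U k f -> Ck_on U k g ->
  Ck_on U k (fun p => f p + g p).
Proof.
elim: k f g => [|k IH] f g [cf df] [cg dg]; split => //;
  try by move=> p Up; apply: continuousD; [exact: cf|exact: cg].
move=> i; have [dfi Cfi] := df i; have [dgi Cgi] := dg i; split.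
  by move=> p Up; apply: derivableD; [exact: dfi|exact: dgi].
apply: Ck_ext (IH _ _ Cfi Cgi) => q Uq.
by rewrite /partial -deriveD //; [exact: dfi|exact: dgi].
Qed.

Lemma Ck_mul k f g : Ck_on U k f -> Ck_on U k g ->
  Ck_on U k (fun p => f p * g p).
Proof.
elim: k f g => [|k IH] f g Ckf Ckg; move: (Ckf) (Ckg) => [cf df] [cg dg];
  split => //; try by move=> p Up; apply: continuousM; [exact: cf|exact: cg].
move=> i; have [dfi Cfi] := df i; have [dgi Cgi] := dg i; split.
  by move=> p Up; apply: derivableM; [exact: dfi|exact: dgi].
apply: Ck_ext (Ck_add (IH _ _ (CkW Ckf) Cgi) (IH _ _ (CkW Ckg) Cfi)) => q Uq.
by rewrite /partial -[RHS]/('D_(eb i) (f * g) q) deriveM //;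
   [exact: dfi|exact: dgi].
Qed.

Lemma Ck_inv k f : (forall p, U p -> f p != 0) -> Ck_on U k f ->
  Ck_on U k (fun p => (f p)^-1).
Proof.
move=> f0; elim: k => [|k IH] Ckf; move: (Ckf) => [cf df]; split => //;
  try by move=> p Up; apply: continuousV; [exact: f0|exact: cf].
move=> i; have [dfi Cfi] := df i; split.
  by move=> p Up; apply: derivableV; [exact: f0|exact: dfi].
have If := IH (CkW Ckf).
apply: Ck_ext (Ck_mul (Ck_mul (Ck_cst k (-1)) (Ck_mul If If)) Cfi) => q Uq.
rewrite /partial deriveV ?f0 //; last exact: dfi.
by rewrite /GRing.scale /= -exprVn expr2 mulN1r.
Qed.

Lemma derive_line (f : rspace R n -> R) p v :
  'D_1 (fun t : R => f (t *: v + p)) 0 = 'D_v f p.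
Proof.
rewrite /derive.
suff -> : (fun h : R => h^-1 *: (((fun t : R => f (t *: v + p)) \o shift 0)
    (h *: 1) - f (0 *: v + p))) =
  (fun h => h^-1 *: ((f \o shift p) (h *: v) - f p)) by [].
by apply/funext => t /=; rewrite addr0 scale0r add0r [_%:A]mulr1.
Qed.

Lemma is_derive_chain (h : R -> R) h' f (p v : rspace R n) :
  is_derive (f p) 1 h h' -> derivable f p v ->
  is_derive p v (h \o f) (h' * 'D_v f p).
Proof.
move=> dh /[dup] df /derivable1P df1.
have dd : is_derive (0 : R) 1 (fun t : R => f (t *: v + p)) ('D_v f p).
  by apply: DeriveDef => //; rewrite derive_line.
have dh0 : is_derive (f (0 *: v + p)) 1 h h' by rewrite scale0r add0r.
have := @is_derive1_comp _ h (fun t : R => f (t *: v + p)) 0 _ _ dh0 dd.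
move=> [dc vc]; apply: DeriveDef; first exact/derivable1P.
by rewrite -(derive_line (h \o f)) -vc.
Qed.

Lemma smooth_ext f g : (forall q, U q -> f q = g q) ->
  smooth_on U f -> smooth_on U g.
Proof. by move=> fg sf k; apply: Ck_ext (sf k). Qed.
Lemma smooth_cst c : smooth_on U (fun=> c). Proof. by move=> k; apply: Ck_cst. Qed.
Lemma smooth_add f g : smooth_on U f -> smooth_on U g ->
  smooth_on U (fun p => f p + g p).
Proof. by move=> sf sg k; apply: Ck_add. Qed.
Lemma smooth_mul f g : smooth_on U f -> smooth_on U g ->
  smooth_on U (fun p => f p * g p).
Proof. by move=> sf sg k; apply: Ck_mul. Qed.
Lemma smooth_inv f : (forall p, U p -> f p != 0) -> smooth_on U f ->
  smooth_on U (fun p => (f p)^-1).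
Proof. by move=> f0 sf k; apply: Ck_inv. Qed.
Lemma smooth_opp f : smooth_on U f -> smooth_on U (fun p => - f p).
Proof.
move=> sf; apply: smooth_ext (smooth_mul (smooth_cst (-1)) sf) => q _.
by rewrite mulN1r.
Qed.
Lemma smooth_sub f g : smooth_on U f -> smooth_on U g ->
  smooth_on U (fun p => f p - g p).
Proof. by move=> sf sg; apply: smooth_add => //; apply: smooth_opp. Qed.
Lemma smooth_exp f k : smooth_on U f -> smooth_on U (fun p => f p ^+ k).
Proof.
move=> sf; elim: k => [|k IH].
  by apply: smooth_ext (smooth_cst 1) => q _; rewrite expr0.
by apply: smooth_ext (smooth_mul sf IH) => q _; rewrite exprS.
Qed.
Lemma smooth_sum (I : Type) (r : seq I) (P : pred I) (F : I -> sfield R n) :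
  (forall i, smooth_on U (F i)) ->
  smooth_on U (fun p => \sum_(i <- r | P i) F i p).
Proof.
move=> sF; elim: r => [|a r IH].
  by apply: smooth_ext (smooth_cst 0) => q _; rewrite big_nil.
case Pa : (P a); last by apply: smooth_ext IH => q _; rewrite big_cons Pa.
by apply: smooth_ext (smooth_add (sF a) IH) => q _; rewrite big_cons Pa.
Qed.
Lemma smooth_prod (I : Type) (r : seq I) (P : pred I) (F : I -> sfield R n) :
  (forall i, smooth_on U (F i)) ->
  smooth_on U (fun p => \prod_(i <- r | P i) F i p).
Proof.
move=> sF; elim: r => [|a r IH].
  by apply: smooth_ext (smooth_cst 1) => q _; rewrite big_nil.
case Pa : (P a); last by apply: smooth_ext IH => q _; rewrite big_cons Pa.
by apply: smooth_ext (smooth_mul (sF a) IH) => q _; rewrite big_cons Pa.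
Qed.
Lemma smooth_cont f p : smooth_on U f -> U p -> {for p, continuous f}.
Proof. by move=> /(_ 0%N); apply: Ck_cont. Qed.
Lemma smooth_der f p i : smooth_on U f -> U p -> derivable f p (eb i).
Proof. by move=> /(_ 1%N) [_ /(_ i) [+ _]] Up; apply. Qed.
Lemma smooth_partial f i : smooth_on U f -> smooth_on U (partial i f).
Proof. by move=> sf k; have [_ /(_ i) []] := sf k.+1. Qed.

Lemma Ck_coord k i : Ck_on U k (fun p => p 0 i).
Proof.
case: k => [|k]; split => //; try by move=> p _; apply: coord_continuous.
move=> j.
have H p : is_derive p (eb j) (fun p : rspace R n => p 0 i) (i == j)%:R.
  have lin : linear (fun p : rspace R n => p 0 i : R).
    by move=> a u v; rewrite !mxE.
  pose L := GRing.isLinear.Build _ _ _ _ _ lin.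
  pose f : {linear rspace R n -> R} := HB.pack (fun p : rspace R n => p 0 i : R) L.
  have cf : continuous f by move=> q; apply: coord_continuous.
  have df : differentiable f p by apply: linear_differentiable.
  apply: DeriveDef; first exact: diff_derivable.
  by rewrite (deriveE _ df) (diff_lin _ cf) /= !mxE eqxx.
split; first by move=> p _; case: (H p).
by apply: Ck_ext (Ck_cst k (i == j)%:R) => q _; rewrite /partial (@derive_val _ _ _ _ _ _ _ (H q)).
Qed.

Lemma smooth_coord i : smooth_on U (fun p => p 0 i).
Proof. by move=> k; apply: Ck_coord. Qed.

Lemma smooth_sqrt f : (forall p, U p -> 0 < f p) -> smooth_on U f ->
  smooth_on U (fun p => Num.sqrt (f p)).
Proof.
move=> f0 sf; elim => [|k IH]; split => //; try by
  move=> p Up; apply: (@continuous_comp _ _ _ f (@Num.sqrt R));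
    [exact: smooth_cont|exact: sqrt_continuous].
move=> i; have H p : U p -> is_derive p (eb i) (Num.sqrt \o f)
    ((2 * Num.sqrt (f p))^-1 * partial i f p).
  by move=> Up; apply: is_derive_chain; [exact/is_derive1_sqrt/f0|exact: smooth_der].
split; first by move=> p /H [].
have C : Ck_on U k (fun p => (2 * Num.sqrt (f p))^-1 * partial i f p).
  apply: Ck_mul; last exact: smooth_partial.
  apply: Ck_inv; last by apply: Ck_mul => //; apply: Ck_cst.
  by move=> p Up; rewrite mulf_neq0 ?pnatr_eq0 // gt_eqF ?sqrtr_gt0 ?f0.
by apply: Ck_ext C => q Uq; rewrite /partial (@derive_val _ _ _ _ _ _ _ (H q Uq)).
Qed.

Lemma smooth_sincos f k : smooth_on U f ->
  Ck_on U k (fun p => sin (f p)) /\ Ck_on U k (fun p => cos (f p)).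
Proof.
move=> sf.
have Hs i p : U p -> is_derive p (eb i) (sin \o f) (cos (f p) * partial i f p).
  by move=> Up; apply: is_derive_chain; exact: smooth_der.
have Hc i p : U p -> is_derive p (eb i) (cos \o f) (- sin (f p) * partial i f p).
  by move=> Up; apply: is_derive_chain; exact: smooth_der.
elim: k => [|k [IHs IHc]]; split; split => //; try by
  move=> p Up; apply: (@continuous_comp _ _ _ f);
    [exact: smooth_cont|first [exact: continuous_sin|exact: continuous_cos]].
- move=> i; split; first by move=> p /(Hs i) [].
  apply: Ck_ext (Ck_mul IHc (smooth_partial i sf k)) => q Uq.
  by rewrite /partial (@derive_val _ _ _ _ _ _ _ (Hs i q Uq)).
- move=> i; split; first by move=> p /(Hc i) [].
  apply: Ck_ext (Ck_mul (Ck_mul (Ck_cst k (-1)) IHs) (smooth_partial i sf k)) => q Uq.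
  by rewrite /partial (@derive_val _ _ _ _ _ _ _ (Hc i q Uq)) mulN1r.
Qed.

Lemma partialD i f g p : smooth_on U f -> smooth_on U g -> U p ->
  partial i (fun q => f q + g q) p = partial i f p + partial i g p.
Proof. by move=> sf sg Up; apply: deriveD; apply: smooth_der. Qed.
Lemma partialM i f g p : smooth_on U f -> smooth_on U g -> U p ->
  partial i (fun q => f q * g q) p = f p * partial i g p + partial i f p * g p.
Proof.
move=> sf sg Up; rewrite [partial i f p * _]mulrC.
by apply: deriveM; apply: smooth_der.
Qed.
Lemma partial_cst (i : 'I_n.+1) (c : R) (p : rspace R n) : partial i (fun=> c) p = 0.
Proof. exact: derive_cst. Qed.
Lemma partial_sum (i : 'I_n.+1) (I : Type) (r : seq I) (F : I -> sfield R n) p :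
  (forall i, smooth_on U (F i)) -> U p ->
  partial i (fun q => \sum_(j <- r) F j q) p = \sum_(j <- r) partial i (F j) p.
Proof.
move=> sF Up; elim: r => [|a r IH].
  rewrite big_nil -[RHS](partial_cst i 0 p); apply: partial_ext => // q _.
  by rewrite big_nil.
rewrite big_cons -IH -partialD //; last exact: smooth_sum.
by apply: partial_ext => // q _; rewrite big_cons.
Qed.

Lemma smooth_lie X f : smooth_vf U X -> smooth_on U f -> smooth_on U (lie X f).
Proof.
move=> sX sf; apply: smooth_sum => i; apply: smooth_mul; first exact: sX.
exact: smooth_partial.
Qed.
Lemma smooth_bracket X Y : smooth_vf U X -> smooth_vf U Y ->
  smooth_vf U (bracket X Y).
Proof.
move=> sX sY i; apply: smooth_ext (smooth_sub (smooth_lie sX (sY i)) (smooth_lie sY (sX i))).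
by move=> q _; rewrite mxE.
Qed.
End Smooth.

Section Christoffel.
Variables (R : realType) (n : nat) (U : set (rspace R n)).
Hypothesis oU : open U.
Variable g : mfield R n.
Hypothesis sg : forall i j, smooth_on U (fun p => g p i j).
Hypothesis gT : forall p, U p -> (g p)^T = g p.
Hypothesis gu : forall p, U p -> g p \in unitmx.

Lemma smooth_det m (A : rspace R n -> 'M[R]_m) :
  (forall i j, smooth_on U (fun p => A p i j)) -> smooth_on U (fun p => \det (A p)).
Proof.
move=> sA; apply: (smooth_sum oU) => s; apply: (smooth_mul oU).
  exact: (smooth_cst oU).
by apply: (smooth_prod oU) => i; exact: sA.
Qed.

Lemma smooth_invg i j : smooth_on U (fun p => invmx (g p) i j).
Proof.
have H : smooth_on U (fun p => (\det (g p))^-1 *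
    ((-1) ^+ (j + i) * \det (row' j (col' i (g p))))).
  apply: (smooth_mul oU).
    apply: (smooth_inv oU); last exact: smooth_det.
    by move=> p /gu; rewrite unitmxE unitfE.
  apply: (smooth_mul oU); first exact: (smooth_cst oU).
  apply: smooth_det => a b.
  by apply: (smooth_ext oU) (sg (lift j a) (lift i b)) => q _; rewrite !mxE.
apply: (smooth_ext oU) H => q Uq.
by rewrite /invmx gu // !mxE.
Qed.

(* Christoffel symbols of the first kind. *)
Definition gam p l i j : R := 2^-1 * (partial i (fun q => g q j l) p
  + partial j (fun q => g q i l) p - partial l (fun q => g q i j) p).
Definition low (X Y : vfield R n) p : 'rV[R]_n.+1 :=
  \row_l \sum_i \sum_j gam p l i j * (X p 0 i * Y p 0 j).
Definition chr (X Y : vfield R n) : vfield R n := fun p =>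
  \row_k lie X (fun q => Y q 0 k) p + low X Y p *m invmx (g p).

Lemma metricE X Y p :
  metric g X Y p = \sum_i \sum_j X p 0 i * (g p i j * Y p 0 j).
Proof.
rewrite /metric -mulmxA mxE; apply: eq_bigr => i _.
by rewrite mxE big_distrr; apply: eq_bigr => j _; rewrite mxE.
Qed.

Lemma gs p i j : U p -> g p i j = g p j i.
Proof. by move=> Up; rewrite -{1}(gT Up) mxE. Qed.
Lemma dgs p i j k : U p ->
  partial k (fun q => g q i j) p = partial k (fun q => g q j i) p.
Proof. by move=> Up; apply: (partial_ext oU) => // q Uq; exact: gs. Qed.

Lemma smooth_chr X Y : smooth_vf U X -> smooth_vf U Y -> smooth_vf U (chr X Y).
Proof.
move=> sX sY k.
have H : smooth_on U (fun p => lie X (fun q => Y q 0 k) p +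
   \sum_l low X Y p 0 l * invmx (g p) l k).
  apply: (smooth_add oU); first exact: (smooth_lie oU sX (sY k)).
  apply: (smooth_sum oU) => l; apply: (smooth_mul oU); last exact: smooth_invg.
  have K : smooth_on U (fun p => \sum_i \sum_j gam p l i j * (X p 0 i * Y p 0 j)).
    apply: (smooth_sum oU) => i; apply: (smooth_sum oU) => j.
    apply: (smooth_mul oU); last exact: (smooth_mul oU).
    apply: (smooth_mul oU); first exact: (smooth_cst oU).
    apply: (smooth_sub oU); last exact: smooth_partial.
    by apply: (smooth_add oU); exact: smooth_partial.
  by apply: (smooth_ext oU) K => q _; rewrite mxE.
by apply: (smooth_ext oU) H => q _; rewrite !mxE.
Qed.

Lemma lieD X f h p : smooth_on U f -> smooth_on U h -> U p ->
  lie X (fun q => f q + h q) p = lie X f p + lie X h p.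
Proof.
move=> sf sh Up; rewrite /lie -big_split; apply: eq_bigr => i _.
by rewrite /= (partialD _ sf sh Up) mulrDr.
Qed.
Lemma lieM X f h p : smooth_on U f -> smooth_on U h -> U p ->
  lie X (fun q => f q * h q) p = f p * lie X h p + lie X f p * h p.
Proof.
move=> sf sh Up; rewrite /lie big_distrr big_distrl -big_split.
by apply: eq_bigr => i _; rewrite /= (partialM _ sf sh Up); ring.
Qed.
Lemma lie_ext X f h p : (forall q, U q -> f q = h q) -> U p ->
  lie X f p = lie X h p.
Proof. by move=> fh Up; apply: eq_bigr => i _; rewrite (partial_ext oU i Up fh). Qed.
Lemma lie_sum X (I : Type) (r : seq I) (F : I -> sfield R n) p :
  (forall i, smooth_on U (F i)) -> U p ->
  lie X (fun q => \sum_(j <- r) F j q) p = \sum_(j <- r) lie X (F j) p.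
Proof.
move=> sF Up; rewrite /lie exchange_big; apply: eq_bigr => i _.
by rewrite (partial_sum oU i r sF Up) big_distrr.
Qed.

Lemma lowC X Y p : U p -> low X Y p = low Y X p.
Proof.
move=> Up; apply/rowP => l; rewrite !mxE exchange_big.
apply: eq_bigr => i _; apply: eq_bigr => j _ /=.
by rewrite /gam (@dgs p i j l Up); ring.
Qed.
Lemma low_addr X Y Y' p : low X (fun q => Y q + Y' q) p = low X Y p + low X Y' p.
Proof.
apply/rowP => l; rewrite !mxE -big_split; apply: eq_bigr => i _ /=.
by rewrite -big_split; apply: eq_bigr => j _ /=; rewrite mxE; ring.
Qed.
Lemma low_scaler X f Y p : low X (fun q => f q *: Y q) p = f p *: low X Y p.
Proof.
apply/rowP => l; rewrite !mxE big_distrr; apply: eq_bigr => i _ /=.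
by rewrite big_distrr; apply: eq_bigr => j _ /=; rewrite mxE; ring.
Qed.

Lemma chr_connection : is_connection U chr.
Proof.
split.
- exact: smooth_chr.
- move=> X X' Y sX sX' sY p Up; rewrite /chr lowC // low_addr mulmxDl.
  rewrite -(lowC X Y) // -(lowC X' Y) //.
  move: (low X Y p *m _) (low X' Y p *m _) => A B.
  apply/rowP => k; rewrite !mxE.
  suff -> : lie (fun q => X q + X' q) (fun q => Y q 0 k) p =
    lie X (fun q => Y q 0 k) p + lie X' (fun q => Y q 0 k) p by ring.
  by rewrite /lie -big_split; apply: eq_bigr => i _; rewrite mxE mulrDl.
- move=> f X Y sf sX sY p Up; rewrite /chr lowC // low_scaler (lowC _ Y) //.
  rewrite -scalemxAl scalerDr; congr (_ + _); apply/rowP => k; rewrite !mxE.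
  by rewrite /lie big_distrr; apply: eq_bigr => i _; rewrite mxE /= mulrA.
- move=> X Y Y' sX sY sY' p Up; rewrite /chr low_addr mulmxDl addrACA.
  congr (_ + _); apply/rowP => k; rewrite !mxE.
  rewrite -(lieD _ (sY k) (sY' k) Up).
  by apply: lie_ext => // q _; rewrite mxE.
- move=> f X Y sf sX sY p Up; rewrite /chr low_scaler -scalemxAl scalerDr addrA.
  congr (_ + _); apply/rowP => k; rewrite !mxE.
  rewrite addrC -(lieM _ sf (sY k) Up).
  by apply: lie_ext => // q _; rewrite mxE.
Qed.

Lemma low_metric (X Y Z : vfield R n) p : U p ->
  \sum_m low X Y p 0 m * Z p 0 m + \sum_m low X Z p 0 m * Y p 0 m =
  \sum_m \sum_i X p 0 i * \sum_j (Y p 0 m * (partial i (fun q => g q m j) p * Z p 0 j)).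
Proof.
move=> Up.
transitivity (\sum_i \sum_j \sum_m X p 0 i * Y p 0 j * Z p 0 m *
   (gam p m i j + gam p j i m)).
  have E1 : \sum_m low X Y p 0 m * Z p 0 m =
     \sum_i \sum_j \sum_m X p 0 i * Y p 0 j * Z p 0 m * gam p m i j.
    under eq_bigr => m _ do rewrite mxE big_distrl /=.
    rewrite exchange_big; apply: eq_bigr => i _ /=.
    under eq_bigr => m _ do rewrite big_distrl /=.
    rewrite exchange_big; apply: eq_bigr => j _ /=.
    by apply: eq_bigr => m _; ring.
  have E2 : \sum_m low X Z p 0 m * Y p 0 m =
     \sum_i \sum_j \sum_m X p 0 i * Y p 0 j * Z p 0 m * gam p j i m.
    under eq_bigr => m _ do rewrite mxE big_distrl /=.
    rewrite exchange_big; apply: eq_bigr => i _ /=.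
    apply: eq_bigr => j _ /=; rewrite big_distrl /=.
    by apply: eq_bigr => m _; ring.
  rewrite E1 E2 -big_split; apply: eq_bigr => i _ /=.
  rewrite -big_split; apply: eq_bigr => j _ /=.
  by rewrite -big_split; apply: eq_bigr => m _ /=; ring.
rewrite exchange_big; apply: eq_bigr => j _ /=.
apply: eq_bigr => i _; rewrite big_distrr; apply: eq_bigr => m _ /=.
rewrite /gam (@dgs p m j i Up).
by field.
Qed.

Lemma low_pair (X Y Z : vfield R n) p : U p ->
  ((low X Y p *m invmx (g p)) *m g p *m (Z p)^T) 0 0 =
  \sum_m low X Y p 0 m * Z p 0 m.
Proof.
move=> Up; rewrite mulmxKV ?gu // mxE.
by apply: eq_bigr => m _; congr (_ * _); rewrite mxE.
Qed.

Lemma metricC X Y p : U p -> metric g X Y p = metric g Y X p.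
Proof.
move=> Up; rewrite !metricE exchange_big; apply: eq_bigr => i _.
by apply: eq_bigr => j _ /=; rewrite (gs _ _ Up); ring.
Qed.

Lemma chr_pair X Y Z p : U p -> metric g (chr X Y) Z p =
  \sum_i \sum_j lie X (fun q => Y q 0 i) p * (g p i j * Z p 0 j) +
  \sum_m low X Y p 0 m * Z p 0 m.
Proof.
move=> Up; rewrite -(low_pair X Y Z Up) /metric /chr !mulmxDl mxE; congr (_ + _).
rewrite -mulmxA mxE; apply: eq_bigr => i _.
by rewrite !mxE big_distrr; apply: eq_bigr => j _; rewrite mxE.
Qed.

Lemma chr_levi_civita : levi_civita U g chr.
Proof.
split; first exact: chr_connection.
- move=> X Y sX sY p Up; rewrite /chr (lowC X Y) // opprD addrACA subrr addr0.
  by apply/rowP => k; rewrite !mxE.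
move=> X Y Z sX sY sZ p Up.
rewrite [metric g Y _ p]metricC // !chr_pair // addrACA low_metric //.
rewrite (@lie_ext X _ (fun q => \sum_i \sum_j Y q 0 i * (g q i j * Z q 0 j))) //;
  last by move=> q _; rewrite metricE.
have sgZ i j : smooth_on U (fun q => g q i j * Z q 0 j) by apply: (smooth_mul oU).
have sYgZ i j : smooth_on U (fun q => Y q 0 i * (g q i j * Z q 0 j)).
  by apply: (smooth_mul oU).
rewrite (@lie_sum X _ _ (fun i q => \sum_j Y q 0 i * (g q i j * Z q 0 j))) //;
  last by move=> i; apply: (smooth_sum oU).
have E i : lie X (fun q => \sum_j Y q 0 i * (g q i j * Z q 0 j)) p =
   \sum_j lie X (fun q => Y q 0 i) p * (g p i j * Z p 0 j) +
   \sum_j lie X (fun q => Z q 0 j) p * (g p j i * Y p 0 i) +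
   \sum_k X p 0 k * \sum_j (Y p 0 i * (partial k (fun q => g q i j) p * Z p 0 j)).
  rewrite (@lie_sum X _ _ (fun j q => Y q 0 i * (g q i j * Z q 0 j))) //.
  under [X in _ = _ + X]eq_bigr => k _ do rewrite big_distrr /=.
  rewrite [X in _ = _ + X]exchange_big /= -!big_split; apply: eq_bigr => j _ /=.
  rewrite (lieM _ (sY i) (sgZ i j) Up) (lieM _ (sg i j) (sZ j) Up).
  rewrite (gs j i Up).
  have -> : \sum_k X p 0 k * (Y p 0 i * (partial k (fun q => g q i j) p * Z p 0 j))
    = Y p 0 i * (lie X (fun q => g q i j) p * Z p 0 j).
    by rewrite /lie big_distrl big_distrr; apply: eq_bigr => k _ /=; ring.
  by ring.
under eq_bigr => i _ do rewrite E.
rewrite !big_split; congr (_ + _ + _) => /=.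
by rewrite exchange_big.
Qed.

Definition eqU (X Y : vfield R n) := forall p, U p -> X p = Y p.
Lemma smooth_eqU X Y : eqU X Y -> smooth_vf U X -> smooth_vf U Y.
Proof. by move=> XY sX i; apply: (smooth_ext oU) (sX i) => q Uq; rewrite XY. Qed.
Lemma chr_eqU X X' Y Y' : eqU X X' -> eqU Y Y' -> eqU (chr X Y) (chr X' Y').
Proof.
move=> XX YY p Up; rewrite /chr.
have -> : low X Y p = low X' Y' p.
  apply/rowP => k; rewrite !mxE.
  by apply: eq_bigr => i _; apply: eq_bigr => j _; rewrite XX // YY.
congr (_ + _); apply/rowP => k; rewrite !mxE.
rewrite (@lie_ext X _ (fun q => Y' q 0 k)) //; last by move=> q Uq; rewrite YY.
by apply: eq_bigr => i _; rewrite XX.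
Qed.
Lemma bracket_eqU X X' Y Y' : eqU X X' -> eqU Y Y' ->
  eqU (bracket X Y) (bracket X' Y').
Proof.
move=> XX YY p Up; apply/rowP => k; rewrite !mxE.
rewrite (@lie_ext X _ (fun q => Y' q 0 k)) //; last by move=> q Uq; rewrite YY.
rewrite (@lie_ext Y _ (fun q => X' q 0 k)) //; last by move=> q Uq; rewrite XX.
by rewrite /lie XX // YY.
Qed.

Let cc := chr_connection.
Lemma smooth_scale f X : smooth_on U f -> smooth_vf U X ->
  smooth_vf U (fun q => f q *: X q).
Proof.
move=> sf sX i; apply: (smooth_ext oU) (smooth_mul oU sf (sX i)) => q _.
by rewrite mxE.
Qed.
Lemma smooth_addv X Y : smooth_vf U X -> smooth_vf U Y ->
  smooth_vf U (fun q => X q + Y q).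
Proof.
move=> sf sX i; apply: (smooth_ext oU) (smooth_add oU (sf i) (sX i)) => q _.
by rewrite mxE.
Qed.

Lemma smooth_curv Z X Y : smooth_vf U Z -> smooth_vf U X -> smooth_vf U Y ->
  smooth_vf U (curvature chr Z X Y).
Proof.
move=> sZ sX sY i.
have A := smooth_chr sZ (smooth_chr sX sY) i.
have B := smooth_chr sX (smooth_chr sZ sY) i.
have C := smooth_chr (smooth_bracket oU sZ sX) sY i.
apply: (smooth_ext oU) (smooth_sub oU (smooth_sub oU A B) C) => q _.
by rewrite !mxE.
Qed.

Lemma curv_scale f Z X Y p : smooth_on U f -> smooth_vf U Z ->
  smooth_vf U X -> smooth_vf U Y -> U p ->
  curvature chr Z (fun q => f q *: X q) Y p = f p *: curvature chr Z X Y p.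
Proof.
move=> sf sZ sX sY Up; rewrite /curvature.
have e1 : eqU (chr (fun q => f q *: X q) Y) (fun q => f q *: chr X Y q).
  by move=> q Uq; rewrite (conn_scalel cc).
rewrite (chr_eqU (fun _ _ => erefl) e1 Up) (conn_leibniz cc) //; last exact: smooth_chr.
rewrite (conn_scalel cc) //; last exact: smooth_chr.
have e2 : eqU (bracket Z (fun q => f q *: X q))
    (fun q => lie Z f q *: X q + f q *: bracket Z X q).
  move=> q Uq; apply/rowP => k; rewrite !mxE.
  rewrite (@lie_ext Z _ (fun q => f q * X q 0 k)) //; last by move=> ? _; rewrite mxE.
  rewrite (lieM _ sf (sX k) Uq).
  have -> : lie (fun q => f q *: X q) (fun r => Z r 0 k) q =
     f q * lie X (fun r => Z r 0 k) q.
    by rewrite /lie big_distrr; apply: eq_bigr => i _; rewrite mxE /= mulrA.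
  by ring.
have sb := smooth_bracket oU sZ sX.
have sl := smooth_lie oU sZ sf.
rewrite (chr_eqU e2 (fun _ _ => erefl) Up).
rewrite (conn_addl cc) ?(conn_scalel cc) //; try exact: smooth_scale.
by apply/rowP => k; rewrite !mxE; ring.
Qed.

Lemma curv_add Z X X' Y p : smooth_vf U Z ->
  smooth_vf U X -> smooth_vf U X' -> smooth_vf U Y -> U p ->
  curvature chr Z (fun q => X q + X' q) Y p = curvature chr Z X Y p + curvature chr Z X' Y p.
Proof.
move=> sZ sX sX' sY Up; rewrite /curvature.
have e1 : eqU (chr (fun q => X q + X' q) Y) (fun q => chr X Y q + chr X' Y q).
  by move=> q Uq; rewrite (conn_addl cc).
rewrite (chr_eqU (fun _ _ => erefl) e1 Up) (conn_addr cc) //; try exact: smooth_chr.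
rewrite (conn_addl cc) //; last exact: smooth_chr.
have e2 : eqU (bracket Z (fun q => X q + X' q))
    (fun q => bracket Z X q + bracket Z X' q).
  move=> q Uq; apply/rowP => k; rewrite !mxE.
  rewrite (@lie_ext Z _ (fun q => X q 0 k + X' q 0 k)) //; last by move=> ? _; rewrite mxE.
  rewrite (lieD _ (sX k) (sX' k) Uq).
  have -> : lie (fun q => X q + X' q) (fun r => Z r 0 k) q =
     lie X (fun r => Z r 0 k) q + lie X' (fun r => Z r 0 k) q.
    by rewrite /lie -big_split; apply: eq_bigr => i _; rewrite mxE /= mulrDl.
  by ring.
rewrite (chr_eqU e2 (fun _ _ => erefl) Up).
rewrite (conn_addl cc) //; try exact: smooth_bracket.
by apply/rowP => k; rewrite !mxE; ring.
Qed.

Lemma smooth_coord_vf i : smooth_vf U (@coord_vf R n i).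
Proof. by move=> j; apply: (smooth_cst oU). Qed.

Lemma ricci_scale f X Y p : smooth_on U f ->
  smooth_vf U X -> smooth_vf U Y -> U p ->
  ricci chr (fun q => f q *: X q) Y p = f p * ricci chr X Y p.
Proof.
move=> sf sX sY Up; rewrite /ricci big_distrr; apply: eq_bigr => k _.
by rewrite (curv_scale sf (smooth_coord_vf k) sX sY Up) mxE.
Qed.
Lemma ricci_add X X' Y p :
  smooth_vf U X -> smooth_vf U X' -> smooth_vf U Y -> U p ->
  ricci chr (fun q => X q + X' q) Y p = ricci chr X Y p + ricci chr X' Y p.
Proof.
move=> sX sX' sY Up; rewrite /ricci -big_split; apply: eq_bigr => k _.
by rewrite (curv_add (smooth_coord_vf k) sX sX' sY Up) mxE.
Qed.
Lemma smooth_ricci X Y : smooth_vf U X -> smooth_vf U Y -> smooth_on U (ricci chr X Y).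
Proof.
move=> sX sY; apply: (smooth_sum oU) => k.
exact: (smooth_curv (smooth_coord_vf k) sX sY k).
Qed.

Lemma ricci_coord X Y p : smooth_vf U X -> smooth_vf U Y -> U p ->
  ricci chr X Y p = \sum_l X p 0 l * ricci chr (coord_vf l) Y p.
Proof.
move=> sX sY Up.
have XE : X = fun q => \sum_l X q 0 l *: @coord_vf R n l q.
  by apply/funext => q; rewrite [LHS]row_sum_delta.
rewrite {1}XE.
have sl l : smooth_vf U (fun q => X q 0 l *: @coord_vf R n l q).
  by apply: smooth_scale; [exact: sX|exact: smooth_coord_vf].
suff H (r : seq 'I_n.+1) :
  smooth_vf U (fun q => \sum_(l <- r) X q 0 l *: @coord_vf R n l q) /\
  ricci chr (fun q => \sum_(l <- r) X q 0 l *: @coord_vf R n l q) Y p =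
   \sum_(l <- r) X p 0 l * ricci chr (coord_vf l) Y p by case: (H (index_enum _)).
elim: r => [|a r [IH1 IH2]].
  have e0 : (fun q => \sum_(l <- [::]) X q 0 l *: @coord_vf R n l q) =
    fun q => (0 : R) *: X q.
    by apply/funext => q; rewrite big_nil scale0r.
  rewrite e0 big_nil; split; first by apply: smooth_scale => //; apply: (smooth_cst oU).
  by rewrite (ricci_scale (smooth_cst oU 0) sX sY Up) mul0r.
have -> : (fun q => \sum_(l <- a :: r) X q 0 l *: @coord_vf R n l q) =
  fun q => X q 0 a *: @coord_vf R n a q + \sum_(l <- r) X q 0 l *: @coord_vf R n l q.
  by apply/funext => q; rewrite big_cons.
split; first exact: smooth_addv.
rewrite big_cons ricci_add // IH2 ricci_scale //; exact: smooth_coord_vf.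
Qed.

Definition Jop (X : vfield R n) : vfield R n := fun p =>
  (\row_l ricci chr (coord_vf l) X p) *m invmx (g p).

Lemma Jop_ricci_operator : ricci_operator U g chr Jop.
Proof.
split.
  move=> X sX k.
  have H : smooth_on U (fun p => \sum_l ricci chr (coord_vf l) X p * invmx (g p) l k).
    apply: (smooth_sum oU) => l; apply: (smooth_mul oU); last exact: smooth_invg.
    by apply: smooth_ricci => //; apply: smooth_coord_vf.
  apply: (smooth_ext oU) H => q _; rewrite mxE; apply: eq_bigr => l _.
  by rewrite mxE.
move=> X Y sX sY p Up; rewrite metricC // /metric /Jop mulmxKV ?gu // mxE.
by rewrite (ricci_coord sX sY Up); apply: eq_bigr => l _; rewrite !mxE mulrC.
Qed.

Lemma levi_civita_exists : exists nabla J, levi_civita U g nabla /\ ricci_operator U g nabla J.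
Proof. by exists chr, Jop; split; [exact: chr_levi_civita|exact: Jop_ricci_operator]. Qed.
End Christoffel.

Section BardeenConnection.
Variables (R : realType) (M e : R).
Hypothesis he : e != 0.
Let U := bardeen_dom M e.
Lemma rho1_gt0 r : 0 < e ^+ 2 + r ^+ 2 :> R.
Proof. by rewrite ltr_pwDl ?sqr_ge0 // exprn_even_gt0. Qed.

Lemma open_bardeen : open U.
Proof.
have cr i : continuous (fun p : 'rV[R]_4 => p 0 i) by apply: coord_continuous.
have ch : continuous (fun p : 'rV[R]_4 => rho1 e (p 0 1) ^+ 3 - 2 * M * p 0 1 ^+ 2).
  move=> p; have s k : smooth_on [set: 'rV[R]_4] (fun p => p 0 1 ^+ k).
    exact/(smooth_exp openT)/(smooth_coord openT).
  apply: (@smooth_cont R 3 setT) => //.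
  apply: (smooth_sub openT).
    apply/(smooth_exp openT)/(smooth_sqrt openT); first by move=> q _; apply: rho1_gt0.
    by apply: (smooth_add openT) => //; apply: (smooth_cst openT).
  by apply: (smooth_mul openT) => //; apply: (smooth_cst openT).
have -> : U = [set p : 'rV[R]_4 | 0 < p 0 1] `&` [set p : 'rV[R]_4 | 0 < p 0 2] `&` [set p : 'rV[R]_4 | p 0 2 < pi]
   `&` [set p : 'rV[R]_4 | rho1 e (p 0 1) ^+ 3 - 2 * M * p 0 1 ^+ 2 != 0].
  apply/seteqP; split => p; rewrite /U /bardeen_dom /= subr_eq0.
    by move=> [-> /andP[-> ->] ->].
  by move=> [[[-> ->] ->] ->].
apply: openI; [apply: openI; [apply: openI|]|].
- exact: (open_comp (fun p _ => cr 1 p) (@open_gt R 0)).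
- exact: (open_comp (fun p _ => cr 2 p) (@open_gt R 0)).
- exact: (open_comp (fun p _ => cr 2 p) (@open_lt R pi)).
- exact: (open_comp (fun p _ => ch p) (@open_neq R 0)).
Qed.

Lemma bardeen_f_neq0 p : U p -> bardeen_f M e (p 0 1) != 0.
Proof.
move=> [r0 _ h]; rewrite /bardeen_f subr_eq0; apply: contra h => /eqP h.
have r3 : rho1 e (p 0 1) ^+ 3 != 0.
  by rewrite expf_neq0 // gt_eqF // sqrtr_gt0 rho1_gt0.
by move: h => /esym/(congr1 ( *%R^~ (rho1 e (p 0 1) ^+ 3))); rewrite mul1r divfK // => ->.
Qed.

Lemma bardeen_levi_civita_exists : exists nabla J,
  levi_civita U (bardeen_metric M e) nabla /\
  ricci_operator U (bardeen_metric M e) nabla J.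
Proof.
have oU := open_bardeen.
apply: levi_civita_exists => //.
- have sl : smooth_on U (fun p => bardeen_f M e (p 0 1)).
    apply: (smooth_sub oU); first exact: (smooth_cst oU).
    apply: (smooth_mul oU).
      apply: (smooth_mul oU); first exact: (smooth_cst oU).
      exact/(smooth_exp oU)/(smooth_coord oU).
    apply: (smooth_inv oU).
      by move=> p _; rewrite expf_neq0 // gt_eqF // sqrtr_gt0 rho1_gt0.
    apply/(smooth_exp oU)/(smooth_sqrt oU); first by move=> q _; apply: rho1_gt0.
    apply: (smooth_add oU); first exact: (smooth_cst oU).
    exact/(smooth_exp oU)/(smooth_coord oU).
  have sr : smooth_on U (fun p => p 0 1 ^+ 2) by exact/(smooth_exp oU)/(smooth_coord oU).
  have ss : smooth_on U (fun p => sin (p 0 2)).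
    by move=> k; have [] := smooth_sincos oU k (smooth_coord oU 2).
  have sd (k : 'I_4) : smooth_on U (fun p => [:: - bardeen_f M e (p 0 1); (bardeen_f M e (p 0 1))^-1; p 0 1 ^+ 2;
                            p 0 1 ^+ 2 * sin (p 0 2) ^+ 2]`_k).
    case: k => [[|[|[|[|//]]]] ?] //=.
    - exact: (smooth_opp oU).
    - exact: (smooth_inv oU bardeen_f_neq0).
    - by apply: (smooth_mul oU) => //; apply: (smooth_exp oU).
  move=> i j; have [ij|ij] := eqVneq i j.
    apply: (smooth_ext oU) (sd i) => q _; rewrite !mxE ij eqxx //.
  by apply: (smooth_ext oU) (smooth_cst oU 0) => q _; rewrite !mxE (negbTE ij).
- by move=> p _; rewrite tr_diag_mx.
- move=> p Up; rewrite unitmxE det_diag unitfE; apply/prodf_neq0 => i _; rewrite !mxE.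
  have [r0 /andP[t0 tp] _] := Up.
  case: i => [[|[|[|[|//]]]] ?] //=.
  + by rewrite oppr_eq0 bardeen_f_neq0.
  + by rewrite invr_eq0 bardeen_f_neq0.
  + by rewrite expf_neq0 // gt_eqF.
  + by rewrite mulf_neq0 // expf_neq0 // gt_eqF // sin_gt0_pi // t0.
Qed.
End BardeenConnection.

(* Main.v *)
Require Import Defs.
From mathcomp Require Import all_boot all_order all_algebra.
From mathcomp Require Import all_classical all_reals all_analysis.
From mathcomp Require Import ring lra.

Set Implicit Arguments.
Unset Strict Implicit.
Unset Printing Implicit Defensive.

Import Order.TTheory GRing.Theory Num.Theory.
Import numFieldNormedType.Exports.

Local Open Scope classical_set_scope.
Local Open Scope ring_scope.

(** The Bardeen metric is static and spherically symmetric: it is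
    [- F dt^2 + F^-1 dr^2 + r^2 (dtheta^2 + sin^2 theta dphi^2)] for a profile
    [F] of [r] alone. It splits as [g = h + k], with [h] on the [(t, r)] base and
    [k] on the sphere. In the coordinate frame the curvature operator of such a
    metric is diagonal ([sph_curvature]), with one eigenvalue per kind of
    coordinate plane: [Kbase = - F'' / 2] for [(t, r)], [Ksphere = (1 - F) / r^2]
    for [(theta, phi)], and [Kmixed = - F' / (2 r)] for the other four planes.
    Writing [/\] for the Kulkarni-Nomizu product, this says
    [R = Kbase / 2 h /\ h + Kmixed h /\ k + Ksphere / 2 k /\ k], and tracing gives
    [S = l h + m k] with [l = Kbase + 2 Kmixed] and [m = 2 Kmixed + Ksphere].

    Everything follows from these two formulas. The Ricci operator has the
    eigenvalues [l] and [m], so that [S^2 - (l + m) S + l m g = 0]: this is the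
    Einstein condition of level 2. Where [l != m], the metric is not Einstein, and
    [h] and [k] are the combinations [(S - m g) / (l - m)] and
    [(l g - S) / (l - m)] of [g] and [S]; substituting them into [R] gives the
    Roter type condition. For the Bardeen profile,
    [l - m = - 15 M e^2 r^2 / rho1^7] ([bardeen_ricci_gap]), which vanishes nowhere
    when [M] and [e] are nonzero.

    The connection is only given by its axioms. It is determined by them on the
    domain ([levi_civita_unique]), hence given by the Christoffel symbols of the
    metric, and the curvature on arbitrary smooth fields is then the usual
    expression in these symbols ([curvature_christoffel]). That the curvature is a
    tensor in its third argument amounts to the symmetry of second derivatives
    ([partialC]). *)

(** * Symmetry of second derivatives *)

(** The hypothesis on [c] says that [c] is an affine line of direction [a]; in
    this form no rearrangement of sums of vectors is needed to recognize one. *)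
Lemma is_derive_line (R : realType) (n : nat) (f : sfield R n)
    (a : 'rV[R]_n.+1) (c : R -> 'rV[R]_n.+1) (s : R) :
  (forall h u, c (h + u) = h *: a + c u) -> derivable f (c s) a ->
  is_derive s 1 (fun u => f (c u)) ('D_a f (c s)).
Proof.
move=> ca.
have E : (fun h : R => h^-1 *: (((fun u : R => f (c u)) \o shift s) (h *: 1) -
    f (c s))) = (fun h => h^-1 *: ((f \o shift (c s)) (h *: a) - f (c s))).
  by apply/funext => h /=; rewrite [_%:A]mulr1 ca.
by move=> df; split; rewrite /derivable /derive E.
Qed.

Lemma mean_value0 (R : realType) (f df : R -> R) (h : R) : 0 < h ->
  (forall s, 0 <= s <= h -> is_derive s 1 f (df s)) ->
  exists2 s, 0 <= s <= h & f h - f 0 = h * df s.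
Proof.
move=> h0 dh; have [||s] := @MVT R f df 0 h h0.
- by move=> s; rewrite in_itv /= => /andP[s0 sh]; apply: dh; rewrite !ltW.
- apply: derivable_within_continuous => s; rewrite in_itv /= => sI.
  by have [] := dh s sI.
rewrite in_itv /= subr0 => /andP[s0 sh] E.
by exists s; rewrite ?ltW // mulrC.
Qed.

(** The mean value theorem is applied to [f (c u h) - f (c u 0)] along [a], then
    to ['D_a f] along [b]. *)
Lemma second_difference (R : realType) (n : nat) (U : set 'rV[R]_n.+1)
    (f : sfield R n) (a b p : 'rV[R]_n.+1) (h : R) : 0 < h ->
  (forall q, U q -> derivable f q a) ->
  (forall q, U q -> derivable (fun r => 'D_a f r) q b) ->
  (forall s t, 0 <= s <= h -> 0 <= t <= h -> U (s *: a + (t *: b + p))) ->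
  exists s t, [/\ 0 <= s <= h, 0 <= t <= h &
    f (h *: a + (h *: b + p)) - f (h *: a + p) - f (h *: b + p) + f p =
    h ^+ 2 * 'D_b (fun r => 'D_a f r) (s *: a + (t *: b + p))].
Proof.
move=> h0 df d2f Uq.
pose c s t := s *: a + (t *: b + p).
have cl k u t : c (k + u) t = k *: a + c u t by rewrite /c scalerDl -[LHS]addrA.
have cr k r u : c r (k + u) = k *: b + c r u.
  by rewrite /c scalerDl -(addrA (k *: b)); apply: addrCA.
have c0 r : c 0 r = r *: b + p by rewrite /c scale0r add0r.
have c0' r : c r 0 = r *: a + p by rewrite /c scale0r add0r.
have hh : 0 <= h <= h by rewrite lexx ltW.
have h00 : (0 : R) <= 0 <= h by rewrite lexx ltW.
have d1 r : 0 <= r <= h -> is_derive r 1 (fun u => f (c u h) - f (c u 0))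
    ('D_a f (c r h) - 'D_a f (c r 0)).
  move=> rh; apply: is_deriveB.
    by apply: (is_derive_line (c := c^~ h)) => //; apply: df; apply: Uq.
  by apply: (is_derive_line (c := c^~ 0)) => //; apply: df; apply: Uq.
have [s sh Es] := mean_value0 h0 d1.
have d2 r : 0 <= r <= h -> is_derive r 1 (fun u => 'D_a f (c s u))
    ('D_b (fun q => 'D_a f q) (c s r)).
  by move=> rh; apply: (is_derive_line (c := c s)) => //; apply: d2f; apply: Uq.
have [t th Et] := mean_value0 h0 d2.
exists s, t; split=> //.
move: Es; rewrite Et c0 !c0' scale0r add0r => Es.
by rewrite expr2 -mulrA -/(c s t) -Es /c; ring.
Qed.

(** The increment of [f] over a square of side [h], divided by [h ^+ 2], is by
    the mean value theorem a value near [p] of either mixed derivative; both are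
    continuous, so letting [h] tend to 0 identifies them. *)
Lemma partialC (R : realType) (n : nat) (U : set 'rV[R]_n.+1) (f : sfield R n)
    (i j : 'I_n.+1) (p : 'rV[R]_n.+1) : open U -> smooth_on U f -> U p ->
  partial i (partial j f) p = partial j (partial i f) p.
Proof.
move=> oU sf Up.
have sF : smooth_on U (partial i (partial j f)) by do 2 apply: smooth_partial.
have sG : smooth_on U (partial j (partial i f)) by do 2 apply: smooth_partial.
apply/eqP; rewrite -subr_eq0 -normr_le0; apply/ler_addgt0Pl => eps eps0.
rewrite addr0.
have e2 : 0 < eps / 2 by rewrite divr_gt0.
have /nbhs_ballP[d /= d0 dB] : \forall q \near p, [/\ U q,
    `|partial i (partial j f) p - partial i (partial j f) q| < eps / 2 &
    `|partial j (partial i f) p - partial j (partial i f) q| < eps / 2].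
  have nU : nbhs p U by apply: open_nbhs_nbhs.
  have close F : smooth_on U F -> \forall q \near p, `|F p - F q| < eps / 2.
    move=> sF'; have cF := smooth_cont sF' Up.
    exact: (@pseudometric_normed_Zmodule.cvgr_dist_lt _ _ _ _ _ _ _ cF).
  have nF := close _ sF; have nG := close _ sG.
  by apply: filterS3 nU nF nG => q Uq Fq Gq; split.
(* A square of side [d / 3] at [p] stays in the ball of radius [d]. *)
pose h := d / 3.
have h0 : 0 < h by rewrite divr_gt0.
have inB (k l : 'I_n.+1) s t : 0 <= s <= h -> 0 <= t <= h ->
    ball p d (s *: ebase R k + (t *: ebase R l + p)).
  move=> /andP[s0 sh] /andP[t0 th].
  split=> // u v; rewrite -ball_normE /= !mxE ltr_norml.
  rewrite /h in sh th; move: (p u v) => x.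
  by case: (_ == _); case: (_ == _); case: (_ == _); rewrite /= ?mulr1 ?mulr0; lra.
have dp k l q : U q -> derivable (partial k f) q (ebase R l).
  by apply: smooth_der; apply: smooth_partial.
have inU k l s t sh th := let: And3 u _ _ := dB _ (inB k l s t sh th) in u.
have df k q : U q -> derivable f q (ebase R k) by apply: smooth_der.
have [s [t [sh th E1]]] := second_difference h0 (df i) (dp i j) (inU i j).
have [s' [t' [sh' th' E2]]] := second_difference h0 (df j) (dp j i) (inU j i).
have E : partial j (partial i f) (s *: ebase R i + (t *: ebase R j + p)) =
  partial i (partial j f) (s' *: ebase R j + (t' *: ebase R i + p)).
  apply: (mulfI (lt0r_neq0 (exprn_gt0 2 h0))).
  apply: etrans (esym E1) _; apply: etrans _ E2.
  have -> : h *: ebase R i + (h *: ebase R j + p) =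
    h *: ebase R j + (h *: ebase R i + p) by apply: addrCA.
  by rewrite (addrAC (f _)).
have [_ _ HG] := dB _ (inB i j s t sh th).
have [_ HF _] := dB _ (inB j i s' t' sh' th').
rewrite E in HG.
set z := partial i (partial j f) (_ + _) in HF HG.
apply: le_trans (ler_distD z _ _) _.
rewrite distrC in HG.
by rewrite (splitr eps); exact: lerD (ltW HF) (ltW HG).
Qed.

(** * Uniqueness of the Levi-Civita connection *)

(** The difference [T A B C] of two Levi-Civita connections, paired with a third
    field, is symmetric in [A], [B] because both are torsion-free and
    skew-symmetric in [B], [C] because both are metric; going around with these
    two symmetries gives [T A B C = - T A B C]. *)
Lemma levi_civita_unique (R : realType) (n : nat) (U : set 'rV[R]_n.+1)
    (g : mfield R n) (nabla nabla' : vfield R n -> vfield R n -> vfield R n) :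
  open U -> (forall p, U p -> (g p)^T = g p) -> (forall p, U p -> g p \in unitmx) ->
  levi_civita U g nabla -> levi_civita U g nabla' ->
  forall X Y, smooth_vf U X -> smooth_vf U Y ->
  forall p, U p -> nabla X Y p = nabla' X Y p.
Proof.
move=> oU gT gu [_ tor met] [_ tor' met'] X Y sX sY p Up.
pose T (A B C : vfield R n) := ((nabla A B p - nabla' A B p) *m g p *m (C p)^T) 0 0.
have TE A B C : T A B C = metric g (nabla A B) C p - metric g (nabla' A B) C p.
  by rewrite /T !mulmxBl [LHS]mxE [X in _ + X]mxE.
have skew A B C : smooth_vf U A -> smooth_vf U B -> smooth_vf U C ->
    T A B C = - T A C B.
  move=> sA sB sC; rewrite !TE.
  have := etrans (esym (met A B C sA sB sC p Up)) (met' A B C sA sB sC p Up).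
  rewrite [metric g B (nabla _ _) _](metricC gT) //.
  rewrite [metric g B (nabla' _ _) _](metricC gT) //.
  lra.
have sym A B C : smooth_vf U A -> smooth_vf U B -> T A B C = T B A C.
  move=> sA sB; rewrite /T; congr ((_ *m _ *m _) _ _).
  have /rowP E := etrans (tor A B sA sB p Up) (esym (tor' A B sA sB p Up)).
  by apply/rowP => k; have := E k; rewrite !mxE; lra.
have T0 C : smooth_vf U C -> T X Y C = 0.
  move=> sC.
  have : T X Y C = - T X Y C.
    rewrite {1}(sym X Y C) // (skew Y X C) // (sym Y C X) // (skew C Y X) //.
    by rewrite opprK (sym C X Y) // (skew X C Y).
  lra.
suff E : (nabla X Y p - nabla' X Y p) *m g p = 0.
  by apply/eqP; rewrite -subr_eq0 -[_ - _](mulmxK (gu p Up)) E mul0mx.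
apply/rowP => k; rewrite [RHS]mxE.
have sk : smooth_vf U (coord_vf k) by apply: smooth_coord_vf.
rewrite -[RHS](T0 _ sk) /T.
by rewrite /coord_vf /ebase trmx_delta -colE [RHS]mxE.
Qed.

(** * Curvature in terms of Christoffel symbols *)

Definition has_christoffel (R : realType) (n : nat) (U : set 'rV[R]_n.+1)
    (nabla : vfield R n -> vfield R n -> vfield R n)
    (Gam : 'I_n.+1 -> 'I_n.+1 -> 'I_n.+1 -> sfield R n) :=
  forall X Y, smooth_vf U X -> smooth_vf U Y -> forall p, U p -> forall k,
    nabla X Y p 0 k = lie X (fun q => Y q 0 k) p +
      \sum_i \sum_j Gam k i j p * X p 0 i * Y p 0 j.

Section Curvature.
Variables (R : realType) (n : nat) (U : set 'rV[R]_n.+1).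
Hypothesis oU : open U.

(** The second-order terms of [lie X (lie Y f)] and [lie Y (lie X f)] agree because
    second derivatives commute. *)
Lemma lie_bracket (X Y : vfield R n) (f : sfield R n) p :
  smooth_vf U X -> smooth_vf U Y -> smooth_on U f -> U p ->
  lie (bracket X Y) f p = lie X (lie Y f) p - lie Y (lie X f) p.
Proof.
move=> sX sY sf Up.
have E (A B : vfield R n) : smooth_vf U A -> smooth_vf U B -> lie A (lie B f) p =
    \sum_i lie A (fun q => B q 0 i) p * partial i f p +
    \sum_i \sum_j A p 0 j * B p 0 i * partial j (partial i f) p.
  move=> sA sB.
  rewrite (@lie_sum _ _ _ oU A _ _ (fun i q => B q 0 i * partial i f q)) //; last first.
    by move=> i; apply: smooth_mul => //; apply: smooth_partial.
  rewrite -big_split; apply: eq_bigr => i _.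
  rewrite (lieM _ (sB i) (smooth_partial i sf)) // addrC; congr (_ + _).
  by rewrite /lie big_distrr; apply: eq_bigr => j _; rewrite /= mulrA [B p 0 i * _]mulrC.
rewrite (E X Y) // (E Y X) //.
have -> : \sum_i \sum_j X p 0 j * Y p 0 i * partial j (partial i f) p =
  \sum_i \sum_j Y p 0 j * X p 0 i * partial j (partial i f) p.
  rewrite exchange_big; apply: eq_bigr => i _; apply: eq_bigr => j _ /=.
  by rewrite (partialC _ _ oU sf Up); ring.
rewrite opprD addrACA subrr addr0 -sumrB; apply: eq_bigr => i _.
by rewrite mxE -mulrBl.
Qed.

Variables (nabla : vfield R n -> vfield R n -> vfield R n)
  (Gam : 'I_n.+1 -> 'I_n.+1 -> 'I_n.+1 -> sfield R n).
Hypothesis sGam : forall k i j, smooth_on U (Gam k i j).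
Hypothesis snabla : forall X Y, smooth_vf U X -> smooth_vf U Y ->
  smooth_vf U (nabla X Y).
Hypothesis nablaE : has_christoffel U nabla Gam.

(** The Christoffel symbols, and their derivatives along [w], as bilinear forms in
    the components of two vectors. *)
Definition christoffel_form k p (u v : 'I_n.+1 -> R) : R :=
  \sum_i \sum_j Gam k i j p * u i * v j.
Definition christoffel_dform k p (w u v : 'I_n.+1 -> R) : R :=
  \sum_i \sum_j (\sum_m w m * partial m (Gam k i j) p) * u i * v j.

Lemma lie_nabla (X Y Z : vfield R n) l p :
  smooth_vf U X -> smooth_vf U Y -> smooth_vf U Z -> U p ->
  lie X (fun q => nabla Y Z q 0 l) p =
    lie X (lie Y (fun q => Z q 0 l)) p +
    christoffel_dform l p (X p 0) (Y p 0) (Z p 0) +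
    christoffel_form l p (fun j => lie X (fun q => Y q 0 j) p) (Z p 0) +
    christoffel_form l p (Y p 0) (fun k => lie X (fun q => Z q 0 k) p).
Proof.
move=> sX sY sZ Up.
have sGY i j : smooth_on U (fun q => Gam l i j q * Y q 0 i).
  by apply: (smooth_mul oU).
have sGYZ i j : smooth_on U (fun q => Gam l i j q * Y q 0 i * Z q 0 j).
  by apply: (smooth_mul oU).
have sS i : smooth_on U (fun q => \sum_j Gam l i j q * Y q 0 i * Z q 0 j).
  exact: (smooth_sum oU).
rewrite (@lie_ext _ _ _ oU X _ (fun q => lie Y (fun r => Z r 0 l) q +
    \sum_i \sum_j Gam l i j q * Y q 0 i * Z q 0 j)) //; last first.
  by move=> q Uq; rewrite nablaE.
rewrite (@lieD _ _ U) //; last exact: (smooth_sum oU).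
  2: exact: (smooth_lie oU).
rewrite (@lie_sum _ _ _ oU X _ _ (fun i q => \sum_j Gam l i j q * Y q 0 i * Z q 0 j)) //.
rewrite -!addrA; congr (_ + _); rewrite addrA -!big_split; apply: eq_bigr => i _.
rewrite (@lie_sum _ _ _ oU X _ _ (fun j q => Gam l i j q * Y q 0 i * Z q 0 j)) //.
rewrite /= -!big_split; apply: eq_bigr => j _ /=.
rewrite (lieM _ (sGY i j) (sZ j)) // (lieM _ (sGam l i j) (sY i)) //.
rewrite -[\sum_m _]/(lie X (Gam l i j) p); ring.
Qed.

(** In the second covariant derivatives of [Z], the second derivatives of the
    components of [Z] are removed by [lie_bracket], and the products of a
    Christoffel symbol by a first derivative cancel in pairs or against
    [nabla (bracket X Y) Z]. *)
Lemma curvature_christoffel (X Y Z : vfield R n) l p :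
  smooth_vf U X -> smooth_vf U Y -> smooth_vf U Z -> U p ->
  curvature nabla X Y Z p 0 l =
    christoffel_dform l p (X p 0) (Y p 0) (Z p 0) -
    christoffel_dform l p (Y p 0) (X p 0) (Z p 0) +
    christoffel_form l p (X p 0)
      (fun m => christoffel_form m p (Y p 0) (Z p 0)) -
    christoffel_form l p (Y p 0)
      (fun m => christoffel_form m p (X p 0) (Z p 0)).
Proof.
move=> sX sY sZ Up.
have formD k u v v' : christoffel_form k p u (fun m => v m + v' m) =
    christoffel_form k p u v + christoffel_form k p u v'.
  rewrite /christoffel_form -big_split; apply: eq_bigr => i _ /=.
  by rewrite -big_split; apply: eq_bigr => j _ /=; ring.
have formB k u u' v : christoffel_form k p (fun m => u m - u' m) v =
    christoffel_form k p u v - christoffel_form k p u' v.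
  rewrite /christoffel_form -sumrB; apply: eq_bigr => i _ /=.
  by rewrite -sumrB; apply: eq_bigr => j _ /=; ring.
have E A B : smooth_vf U A -> smooth_vf U B -> nabla A (nabla B Z) p 0 l =
    lie A (lie B (fun q => Z q 0 l)) p +
    christoffel_dform l p (A p 0) (B p 0) (Z p 0) +
    christoffel_form l p (fun j => lie A (fun q => B q 0 j) p) (Z p 0) +
    christoffel_form l p (B p 0) (fun k => lie A (fun q => Z q 0 k) p) +
    christoffel_form l p (A p 0) (fun k => lie B (fun q => Z q 0 k) p) +
    christoffel_form l p (A p 0)
      (fun m => christoffel_form m p (B p 0) (Z p 0)).
  move=> sA sB; rewrite nablaE //; last exact: snabla.
  rewrite lie_nabla // -[X in _ = X]addrA -formD; congr (_ + _).
  apply: eq_bigr => i _; apply: eq_bigr => j _.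
  by rewrite nablaE.
have sXY : smooth_vf U (bracket X Y) by apply: smooth_bracket.
rewrite /curvature !mxE E // E // nablaE // (lie_bracket sX sY (sZ l)) //.
have -> : \sum_i \sum_j Gam l i j p * bracket X Y p 0 i * Z p 0 j =
    christoffel_form l p (fun j => lie X (fun q => Y q 0 j) p) (Z p 0) -
    christoffel_form l p (fun j => lie Y (fun q => X q 0 j) p) (Z p 0).
  rewrite -formB; apply: eq_bigr => i _; apply: eq_bigr => j _.
  by rewrite mxE.
ring.
Qed.
End Curvature.

(** * Derivatives of functions of one coordinate *)

Section RealDerivatives.
Variables (R : realType) (x : R).
Implicit Types (f : R -> R) (a b : R).

Lemma rderive_cst (c : R) : is_derive x 1 (fun=> c) 0. Proof. exact: is_derive_cst. Qed.
Lemma rderive_id : is_derive x 1 (fun t : R => t) 1. Proof. exact: is_derive_id. Qed.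
Lemma rderive_add f h a b : is_derive x 1 f a -> is_derive x 1 h b ->
  is_derive x 1 (fun t => f t + h t) (a + b).
Proof. by move=> df dh; apply: is_deriveD. Qed.
Lemma rderive_opp f a : is_derive x 1 f a -> is_derive x 1 (fun t => - f t) (- a).
Proof. by move=> df; apply: is_deriveN. Qed.
Lemma rderive_mul f h a b : is_derive x 1 f a -> is_derive x 1 h b ->
  is_derive x 1 (fun t => f t * h t) (f x * b + a * h x).
Proof.
by move=> df dh; rewrite [a * _]mulrC; apply: is_deriveM.
Qed.
Lemma rderive_inv f a : f x != 0 -> is_derive x 1 f a ->
  is_derive x 1 (fun t => (f t)^-1) (- a / f x ^+ 2).
Proof.
move=> f0 df; apply: is_derive_eq (is_deriveV f0 df) _.
by rewrite /GRing.scale /=; field.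
Qed.
Lemma rderive_exp f a m : is_derive x 1 f a ->
  is_derive x 1 (fun t => f t ^+ m) (m%:R * f x ^+ m.-1 * a).
Proof.
move=> df; have -> : (fun t => f t ^+ m) = f ^+ m.
  by apply/funext => t; rewrite fctE.
apply: is_derive_eq (is_deriveX m df) _.
by rewrite /GRing.scale /= mulr_natl.
Qed.
End RealDerivatives.

(** The metric and the Christoffel symbols of a static spherically symmetric metric
    have components of this form, with [i] and [j] the indices of [r] and [theta]. *)
Lemma partial_coord_mul (R : realType) (n : nat) (f h : R -> R) (a b : R)
    (m i j : 'I_n.+1) (p : 'rV[R]_n.+1) :
  is_derive (p 0 i) 1 f a -> is_derive (p 0 j) 1 h b ->
  partial m (fun q => f (q 0 i) * h (q 0 j)) p =
  (m == i)%:R * (a * h (p 0 j)) + (m == j)%:R * (f (p 0 i) * b).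
Proof.
have dc k : is_derive p (ebase R m) (fun q : 'rV[R]_n.+1 => q 0 k) (m == k)%:R.
  have sk : smooth_on setT (fun q : 'rV[R]_n.+1 => q 0 k).
    exact: (smooth_coord openT).
  apply: DeriveDef; first by apply: smooth_der; [exact: sk|].
  rewrite -derive_line.
  have -> : (fun t : R => (t *: ebase R m + p) 0 k) =
      fun t => t * (m == k)%:R + p 0 k.
    by apply/funext => t; rewrite !mxE /= eq_sym.
  have D := rderive_add (rderive_mul (rderive_id 0) (rderive_cst 0 (m == k)%:R))
    (rderive_cst 0 (p 0 k)).
  by rewrite (@derive_val _ _ _ _ _ _ _ D); ring.
move=> df dh.
have ch k (u : R -> R) c : is_derive (p 0 k) 1 u c ->
    is_derive p (ebase R m) (fun q : 'rV[R]_n.+1 => u (q 0 k)) (c * (m == k)%:R).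
  move=> du; have [dk <-] := dc k.
  exact: (is_derive_chain du dk).
have D := is_deriveM (ch i f a df) (ch j h b dh).
rewrite /partial (@derive_val _ _ _ _ _ _ _ D) /GRing.scale /=.
ring.
Qed.

(** * Diagonal metrics *)

Section DiagonalMetric.
Variables (R : realType) (n : nat) (U : set 'rV[R]_n.+1).
Hypothesis oU : open U.
Variable d : 'I_n.+1 -> sfield R n.
Hypothesis sd : forall i, smooth_on U (d i).
Hypothesis d0 : forall i p, U p -> d i p != 0.

Definition diagonal_metric : mfield R n := fun p => diag_mx (\row_i d i p).

Lemma diagonal_metric_smooth i j : smooth_on U (fun p => diagonal_metric p i j).
Proof.
have [ij|ij] := eqVneq i j.
  by apply: (smooth_ext oU) (sd i) => q _; rewrite !mxE ij eqxx.
by apply: (smooth_ext oU) (smooth_cst oU 0) => q _; rewrite !mxE (negbTE ij).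
Qed.

Lemma diagonal_metric_sym p : (diagonal_metric p)^T = diagonal_metric p.
Proof. exact: tr_diag_mx. Qed.

Lemma diagonal_metric_unit p : U p -> diagonal_metric p \in unitmx.
Proof.
move=> Up; rewrite unitmxE det_diag unitfE; apply/prodf_neq0 => i _.
by rewrite mxE d0.
Qed.

Lemma diagonal_metricE X Y p :
  metric diagonal_metric X Y p = \sum_i d i p * X p 0 i * Y p 0 i.
Proof.
rewrite metricE; apply: eq_bigr => i _; rewrite (bigD1 i) //= big1 => [|j ji].
  by rewrite !mxE eqxx addr0 mulrA [X p 0 i * _]mulrC.
by rewrite !mxE eq_sym (negbTE ji) mul0r mulr0.
Qed.

Definition diagonal_christoffel k i j : sfield R n := fun p =>
  (2 * d k p)^-1 * ((j == k)%:R * partial i (d k) p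
    + (i == k)%:R * partial j (d k) p - (i == j)%:R * partial k (d i) p).

(** By uniqueness it is enough to read off the symbols of the explicit Levi-Civita
    connection [chr]. *)
Lemma diagonal_has_christoffel nabla :
  levi_civita U diagonal_metric nabla ->
  has_christoffel U nabla diagonal_christoffel.
Proof.
move=> hnabla X Y sX sY p Up k.
have gT q : U q -> (diagonal_metric q)^T = diagonal_metric q.
  by move=> _; apply: diagonal_metric_sym.
have hchr := chr_levi_civita oU diagonal_metric_smooth gT diagonal_metric_unit.
rewrite (levi_civita_unique oU gT diagonal_metric_unit hnabla hchr) //.
have part i j m : partial m (fun q => diagonal_metric q i j) p =
    (i == j)%:R * partial m (d i) p.
  have [ij|ij] := eqVneq i j.
    rewrite mul1r; apply: (partial_ext oU) => // q _.
    by rewrite !mxE ij eqxx.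
  rewrite mul0r -(partial_cst m 0 p); apply: (partial_ext oU) => // q _.
  by rewrite !mxE (negbTE ij).
rewrite /chr.
have -> : invmx (diagonal_metric p) = diag_mx (\row_i (d i p)^-1).
  apply: (can_inj (mulKmx (diagonal_metric_unit Up))).
  rewrite mulmxV ?diagonal_metric_unit // mulmx_diag.
  apply/matrixP => i j; rewrite !mxE.
  by case: eqP => // _; rewrite divff // d0.
rewrite mxE [X in X + _]mxE; congr (_ + _).
rewrite mul_mx_diag.
rewrite !mxE big_distrl; apply: eq_bigr => i _ /=.
rewrite big_distrl; apply: eq_bigr => j _ /=.
rewrite /gam /diagonal_christoffel !part.
have dk := d0 k Up.
by have [->|jk] := eqVneq j k; have [->|ik] := eqVneq i k;
  rewrite ?eqxx /= ?mul0r ?mul1r; field; rewrite ?dk.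
Qed.
End DiagonalMetric.

(** * Static spherically symmetric metrics *)

Section StaticSpherical.
Variables (R : realType) (U : set 'rV[R]_4) (F F1 F2 : R -> R).
Hypothesis oU : open U.
Hypothesis r_neq0 : forall p, U p -> p 0 1 != 0.
Hypothesis s_neq0 : forall p, U p -> sin (p 0 2) != 0.
Hypothesis F_neq0 : forall p, U p -> F (p 0 1) != 0.
Hypothesis F_der : forall p, U p -> is_derive (p 0 1) 1 F (F1 (p 0 1)).
Hypothesis F1_der : forall p, U p -> is_derive (p 0 1) 1 F1 (F2 (p 0 1)).
Hypothesis F_smooth : smooth_on U (fun p => F (p 0 1)).
Hypothesis F1_smooth : smooth_on U (fun p => F1 (p 0 1)).

(** The coordinates [t], [r], [theta], [phi] have indices 0, 1, 2, 3; [F1] and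
    [F2] are the first two derivatives of [F]. *)
Definition sph_diag (i : 'I_4) : sfield R 3 := fun p =>
  [:: - F (p 0 1); (F (p 0 1))^-1; p 0 1 ^+ 2; p 0 1 ^+ 2 * sin (p 0 2) ^+ 2]`_i.

(** Each Christoffel symbol is a function of [r] times a function of [theta]: the
    tables [sph_radial] and [sph_angular] list these factors, and [sph_radial1] and
    [sph_angular1] their derivatives. The derivative of [cos / sin] is written
    [- (1 + (cos / sin)^2)], so that the curvature is obtained by field operations
    alone, without the relation between [sin] and [cos]. *)
Definition sph_radial (k i j : nat) (r : R) : R := match k, i, j with
  | 0, 0, 1 | 0, 1, 0 => F1 r * (2 * F r)^-1
  | 1, 0, 0 => 2^-1 * (F r * F1 r)
  | 1, 1, 1 => - (F1 r * (2 * F r)^-1)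
  | 1, 2, 2 | 1, 3, 3 => - (r * F r)
  | 2, 1, 2 | 2, 2, 1 | 3, 1, 3 | 3, 3, 1 => r^-1
  | 2, 3, 3 | 3, 2, 3 | 3, 3, 2 => 1
  | _, _, _ => 0
  end.
Definition sph_radial1 (k i j : nat) (r : R) : R := match k, i, j with
  | 0, 0, 1 | 0, 1, 0 => (F2 r * F r - F1 r ^+ 2) / (2 * F r ^+ 2)
  | 1, 0, 0 => 2^-1 * (F r * F2 r + F1 r ^+ 2)
  | 1, 1, 1 => - ((F2 r * F r - F1 r ^+ 2) / (2 * F r ^+ 2))
  | 1, 2, 2 | 1, 3, 3 => - (F r + r * F1 r)
  | 2, 1, 2 | 2, 2, 1 | 3, 1, 3 | 3, 3, 1 => - r ^- 2
  | _, _, _ => 0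
  end.
Definition sph_angular (k i j : nat) (th : R) : R := match k, i, j with
  | 1, 3, 3 => sin th ^+ 2
  | 2, 3, 3 => - (sin th * cos th)
  | 3, 2, 3 | 3, 3, 2 => cos th / sin th
  | _, _, _ => 1
  end.
Definition sph_angular1 (k i j : nat) (th : R) : R := match k, i, j with
  | 1, 3, 3 => 2 * sin th * cos th
  | 2, 3, 3 => sin th ^+ 2 - cos th ^+ 2
  | 3, 2, 3 | 3, 3, 2 => - (1 + (cos th / sin th) ^+ 2)
  | _, _, _ => 0
  end.

Definition sph_christoffel (k i j : 'I_4) : sfield R 3 := fun p =>
  sph_radial k i j (p 0 1) * sph_angular k i j (p 0 2).

Let sr : smooth_on U (fun p => p 0 1). Proof. exact: (smooth_coord oU). Qed.
Let ss : smooth_on U (fun p => sin (p 0 2)).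
Proof. by move=> k; have [] := smooth_sincos oU k (smooth_coord oU 2). Qed.
Let sc : smooth_on U (fun p => cos (p 0 2)).
Proof. by move=> k; have [] := smooth_sincos oU k (smooth_coord oU 2). Qed.

Lemma sph_diag_smooth i : smooth_on U (sph_diag i).
Proof.
case: i => [[|[|[|[|//]]]] ?].
- exact: (smooth_opp oU).
- exact: (smooth_inv oU).
- exact: (smooth_exp oU).
- by apply: (smooth_mul oU); apply: (smooth_exp oU).
Qed.

Lemma sph_diag_neq0 i p : U p -> sph_diag i p != 0.
Proof.
move=> Up; case: i => [[|[|[|[|//]]]] ?]; rewrite /sph_diag /=.
- by rewrite oppr_eq0 F_neq0.
- by rewrite invr_eq0 F_neq0.
- by rewrite expf_neq0 // r_neq0.
- by rewrite mulf_neq0 // expf_neq0 // ?r_neq0 ?s_neq0.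
Qed.

Lemma sph_christoffel_smooth k i j : smooth_on U (sph_christoffel k i j).
Proof.
have s2F : smooth_on U (fun p => F1 (p 0 1) * (2 * F (p 0 1))^-1).
  apply: (smooth_mul oU) => //; apply: (smooth_inv oU).
    by move=> p Up; rewrite mulf_neq0 ?pnatr_eq0 // F_neq0.
  by apply: (smooth_mul oU) => //; apply: (smooth_cst oU).
have sFF : smooth_on U (fun p => 2^-1 * (F (p 0 1) * F1 (p 0 1))).
  by apply: (smooth_mul oU); [apply: (smooth_cst oU)|apply: (smooth_mul oU)].
have srF : smooth_on U (fun p => - (p 0 1 * F (p 0 1))).
  by apply/(smooth_opp oU)/(smooth_mul oU).
have srI : smooth_on U (fun p => (p 0 1)^-1) by apply: (smooth_inv oU).
have s1 := smooth_cst oU 1.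
apply: (smooth_mul oU).
  case: k i j => [[|[|[|[|//]]]] ?] [[|[|[|[|//]]]] ?] [[|[|[|[|//]]]] ?] //=;
  try exact: (smooth_cst oU 0).
  exact: (smooth_opp oU).
case: k i j => [[|[|[|[|//]]]] ?] [[|[|[|[|//]]]] ?] [[|[|[|[|//]]]] ?] //=.
- exact: (smooth_exp oU).
- by apply/(smooth_opp oU)/(smooth_mul oU).
- by apply: (smooth_mul oU) => //; apply: (smooth_inv oU).
- by apply: (smooth_mul oU) => //; apply: (smooth_inv oU).
Qed.

Lemma partial_sph_christoffel m (k i j : 'I_4) p : U p ->
  partial m (sph_christoffel k i j) p =
  (m == 1)%:R * (sph_radial1 k i j (p 0 1) * sph_angular k i j (p 0 2)) +
  (m == 2)%:R * (sph_radial k i j (p 0 1) * sph_angular1 k i j (p 0 2)).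
Proof.
move=> Up; apply: partial_coord_mul.
  have [Fn rn] := (F_neq0 Up, r_neq0 Up).
  have [dF dF1] := (F_der Up, F1_der Up).
  have d2F : is_derive (p 0 1) 1 (fun r => F1 r * (2 * F r)^-1)
      ((F2 (p 0 1) * F (p 0 1) - F1 (p 0 1) ^+ 2) / (2 * F (p 0 1) ^+ 2)).
    have n2 : 2 * F (p 0 1) != 0 by rewrite mulf_neq0 ?pnatr_eq0.
    apply: is_derive_eq (rderive_mul dF1
      (@rderive_inv _ _ (fun r => 2 * F r) _ n2 (rderive_mul (rderive_cst _ 2) dF))) _.
    by field.
  have dFF : is_derive (p 0 1) 1 (fun r => 2^-1 * (F r * F1 r))
      (2^-1 * (F (p 0 1) * F2 (p 0 1) + F1 (p 0 1) ^+ 2)).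
    by apply: is_derive_eq (rderive_mul (rderive_cst _ 2^-1) (rderive_mul dF dF1)) _; ring.
  have drF : is_derive (p 0 1) 1 (fun r => - (r * F r))
      (- (F (p 0 1) + p 0 1 * F1 (p 0 1))).
    by apply: is_derive_eq (rderive_opp (rderive_mul (rderive_id _) dF)) _; ring.
  have drV : is_derive (p 0 1) 1 (fun r : R => r^-1) (- (p 0 1) ^- 2).
    by apply: is_derive_eq (@rderive_inv _ _ id _ rn (rderive_id _)) _; rewrite mulN1r.
  case: k i j => [[|[|[|[|//]]]] ?] [[|[|[|[|//]]]] ?] [[|[|[|[|//]]]] ?] //=;
    try exact: rderive_cst.
  exact: rderive_opp.
have sn := s_neq0 Up.
case: k i j => [[|[|[|[|//]]]] ?] [[|[|[|[|//]]]] ?] [[|[|[|[|//]]]] ?] //=;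
  try exact: rderive_cst.
- by apply: is_derive_eq (rderive_exp 2 (is_derive_sin _)) _; rewrite /= expr1.
- by apply: is_derive_eq (rderive_opp (rderive_mul (is_derive_sin _) (is_derive_cos _))) _; ring.
- by apply: is_derive_eq (rderive_mul (is_derive_cos _)
    (@rderive_inv _ _ sin _ sn (is_derive_sin _))) _; field.
- by apply: is_derive_eq (rderive_mul (is_derive_cos _)
    (@rderive_inv _ _ sin _ sn (is_derive_sin _))) _; field.
Qed.

Variable nabla : vfield R 3 -> vfield R 3 -> vfield R 3.
Hypothesis hnabla : levi_civita U (diagonal_metric sph_diag) nabla.

Lemma partial_sph_diag m i p : U p -> partial m (sph_diag i) p =
  (m == 1)%:R * [:: - F1 (p 0 1); - F1 (p 0 1) / F (p 0 1) ^+ 2; 2 * p 0 1;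
                   2 * p 0 1 * sin (p 0 2) ^+ 2]`_i +
  (m == 2)%:R * [:: 0; 0; 0; p 0 1 ^+ 2 * (2 * sin (p 0 2) * cos (p 0 2))]`_i.
Proof.
move=> Up; have [Fn rn dF] := And3 (F_neq0 Up) (r_neq0 Up) (F_der Up).
pose a := [:: (fun r => - F r); (fun r => (F r)^-1); (fun r => r ^+ 2);
  (fun r => r ^+ 2)].
pose b := [:: (fun=> 1); (fun=> 1); (fun=> 1); (fun t : R => sin t ^+ 2)].
pose da := [:: - F1 (p 0 1); - F1 (p 0 1) / F (p 0 1) ^+ 2; 2 * p 0 1; 2 * p 0 1].
pose db : seq R := [:: 0; 0; 0; 2 * sin (p 0 2) * cos (p 0 2)].
have -> : sph_diag i = fun q =>
    nth (fun=> 0) a i (q 0 1) * nth (fun=> 0) b i (q 0 2).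
  apply/funext => q; case: i => [[|[|[|[|//]]]] ?];
  by rewrite /sph_diag /a /b /= ?mulr1.
have da' : is_derive (p 0 1) 1 (nth (fun=> 0) a i) da`_i.
  have d2 := rderive_exp 2 (rderive_id (p 0 1)); rewrite /= expr1 mulr1 in d2.
  case: i => [[|[|[|[|//]]]] ?] //=; first exact: rderive_opp.
  exact: rderive_inv.
have db' : is_derive (p 0 2) 1 (nth (fun=> 0) b i) db`_i.
  case: i {da'} => [[|[|[|[|//]]]] ?] /=; try exact: rderive_cst.
  by apply: is_derive_eq (rderive_exp 2 (is_derive_sin _)) _; rewrite /= expr1.
rewrite (partial_coord_mul m da' db').
by case: i da' db' => [[|[|[|[|//]]]] ?] _ _; rewrite /a /b /da /db /=; ring.
Qed.

Lemma sph_has_christoffel : has_christoffel U nabla sph_christoffel.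
Proof.
move=> X Y sX sY p Up k.
rewrite (diagonal_has_christoffel oU sph_diag_smooth sph_diag_neq0 hnabla) //.
congr (_ + _); apply: eq_bigr => i _; apply: eq_bigr => j _.
congr (_ * _ * _); rewrite /diagonal_christoffel !partial_sph_diag //.
have [Fn rn sn] := And3 (F_neq0 Up) (r_neq0 Up) (s_neq0 Up).
rewrite /sph_diag /sph_christoffel.
case: k i j => [[|[|[|[|//]]]] ?] [[|[|[|[|//]]]] ?] [[|[|[|[|//]]]] ?].
all: rewrite -!val_eqE /=.
all: by field; rewrite ?Fn ?rn ?sn.
Qed.

(** The sectional curvatures of the coordinate planes: [sph_sectional i j] is the
    one of the plane of the coordinates [i] and [j]. *)
Definition sph_Kbase (r : R) := - (F2 r / 2).
Definition sph_Kmixed (r : R) := - (F1 r / (2 * r)).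
Definition sph_Ksphere (r : R) := (1 - F r) / r ^+ 2.
Definition sph_sectional (i j : nat) (r : R) : R := match i, j with
  | 0, 1 | 1, 0 => sph_Kbase r
  | 0, 2 | 2, 0 | 0, 3 | 3, 0 | 1, 2 | 2, 1 | 1, 3 | 3, 1 => sph_Kmixed r
  | 2, 3 | 3, 2 => sph_Ksphere r
  | _, _ => 0
  end.

Lemma ord4_cases (i : 'I_4) : [\/ i = 0, i = 1, i = 2 | i = 3].
Proof.
by case: i => [[|[|[|[|//]]]] ?];
  [apply: Or41|apply: Or42|apply: Or43|apply: Or44]; apply: val_inj.
Qed.

Lemma sum4 (G : 'I_4 -> R) : \sum_i G i = G 0 + G 1 + G 2 + G 3.
Proof.
rewrite !big_ord_recl big_ord0 addr0 !addrA.
by congr (G _ + G _ + G _ + G _); apply: val_inj.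
Qed.

Lemma sph_christoffel_form (k : 'I_4) p u v :
  christoffel_form sph_christoffel k p u v =
  let r := p 0 1 in let s := sin (p 0 2) in let c := cos (p 0 2) in
  [:: F1 r / (2 * F r) * (u 0 * v 1 + u 1 * v 0);
      2^-1 * (F r * F1 r) * (u 0 * v 0) - F1 r / (2 * F r) * (u 1 * v 1)
        - r * F r * (u 2 * v 2 + s ^+ 2 * (u 3 * v 3));
      r^-1 * (u 1 * v 2 + u 2 * v 1) - s * c * (u 3 * v 3);
      r^-1 * (u 1 * v 3 + u 3 * v 1) + c / s * (u 2 * v 3 + u 3 * v 2)]`_k.
Proof.
rewrite /christoffel_form /sph_christoffel !sum4.
by case: k => [[|[|[|[|//]]]] ?] /=; ring.
Qed.

Lemma sph_christoffel_dform (k : 'I_4) p w u v : U p ->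
  christoffel_dform sph_christoffel k p w u v =
  let r := p 0 1 in let s := sin (p 0 2) in let c := cos (p 0 2) in
  let a' := (F2 r * F r - F1 r ^+ 2) / (2 * F r ^+ 2) in
  [:: w 1 * a' * (u 0 * v 1 + u 1 * v 0);
      w 1 * (2^-1 * (F r * F2 r + F1 r ^+ 2) * (u 0 * v 0) - a' * (u 1 * v 1)
        - (F r + r * F1 r) * (u 2 * v 2 + s ^+ 2 * (u 3 * v 3)))
        - w 2 * (r * F r * (2 * s * c) * (u 3 * v 3));
      - w 1 * r ^- 2 * (u 1 * v 2 + u 2 * v 1)
        + w 2 * (s ^+ 2 - c ^+ 2) * (u 3 * v 3);
      - w 1 * r ^- 2 * (u 1 * v 3 + u 3 * v 1)
        - w 2 * (1 + (c / s) ^+ 2) * (u 2 * v 3 + u 3 * v 2)]`_k.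
Proof.
move=> Up; rewrite /christoffel_dform.
have dE i j : \sum_m w m * partial m (sph_christoffel k i j) p =
    w 1 * (sph_radial1 k i j (p 0 1) * sph_angular k i j (p 0 2)) +
    w 2 * (sph_radial k i j (p 0 1) * sph_angular1 k i j (p 0 2)).
  by rewrite sum4 !partial_sph_christoffel //=; ring.
under eq_bigr => i _ do under eq_bigr => j _ do rewrite dE.
rewrite !sum4.
by case: k {dE} => [[|[|[|[|//]]]] ?] /=; ring.
Qed.

(** The curvature operator is diagonal in the coordinate frame: compare
    [R(X,Y)Z = K (g(Y,Z) X - g(X,Z) Y)] in constant curvature [K]. *)
Lemma sph_curvature X Y Z (l : 'I_4) p :
  smooth_vf U X -> smooth_vf U Y -> smooth_vf U Z -> U p ->
  curvature nabla X Y Z p 0 l =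
    \sum_(j < 4) sph_sectional l j (p 0 1) * sph_diag j p * Z p 0 j *
      (X p 0 l * Y p 0 j - X p 0 j * Y p 0 l).
Proof.
move=> sX sY sZ Up.
rewrite (curvature_christoffel oU sph_christoffel_smooth
  (conn_smooth (lc_connection hnabla)) sph_has_christoffel) //.
have [Fn rn sn] := And3 (F_neq0 Up) (r_neq0 Up) (s_neq0 Up).
rewrite !sph_christoffel_dform // !sph_christoffel_form sum4.
rewrite /sph_diag /sph_sectional /sph_Kbase /sph_Kmixed /sph_Ksphere.
case: (ord4_cases l) => -> /=.
all: by field; rewrite ?Fn ?rn ?sn.
Qed.

Definition sph_base : tensor2 R 3 := fun X Y p =>
  - F (p 0 1) * (X p 0 0 * Y p 0 0) + (F (p 0 1))^-1 * (X p 0 1 * Y p 0 1).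
Definition sph_sphere : tensor2 R 3 := fun X Y p => p 0 1 ^+ 2 *
  (X p 0 2 * Y p 0 2 + sin (p 0 2) ^+ 2 * (X p 0 3 * Y p 0 3)).

(** The Ricci curvature in a coordinate direction is the sum of the sectional
    curvatures of the three coordinate planes containing it. *)
Definition sph_ricci_base r := sph_Kbase r + 2 * sph_Kmixed r.
Definition sph_ricci_sphere r := 2 * sph_Kmixed r + sph_Ksphere r.

Local Notation g := (diagonal_metric sph_diag).

Lemma sph_metric_split X Y p : metric g X Y p = sph_base X Y p + sph_sphere X Y p.
Proof. by rewrite diagonal_metricE sum4 /sph_diag /sph_base /sph_sphere /=; ring. Qed.

Lemma sph_ricci X Y p : smooth_vf U X -> smooth_vf U Y -> U p ->
  ricci nabla X Y p =
  sph_ricci_base (p 0 1) * sph_base X Y p + sph_ricci_sphere (p 0 1) * sph_sphere X Y p.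
Proof.
move=> sX sY Up; rewrite /ricci.
have sco l : smooth_vf U (@coord_vf R 3 l) by apply: smooth_coord_vf.
under eq_bigr => l _ do rewrite sph_curvature //.
rewrite !sum4 /coord_vf /ebase !mxE /=.
rewrite /sph_ricci_base /sph_ricci_sphere /sph_base /sph_sphere /sph_diag /=.
ring.
Qed.

Lemma sph_riemann X1 X2 X3 X4 p : smooth_vf U X1 -> smooth_vf U X2 ->
  smooth_vf U X3 -> smooth_vf U X4 -> U p ->
  riemann g nabla X1 X2 X3 X4 p =
    sph_Kbase (p 0 1) / 2 * kulkarni_nomizu sph_base sph_base X1 X2 X3 X4 p
  + sph_Kmixed (p 0 1) * kulkarni_nomizu sph_base sph_sphere X1 X2 X3 X4 p
  + sph_Ksphere (p 0 1) / 2 * kulkarni_nomizu sph_sphere sph_sphere X1 X2 X3 X4 p.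
Proof.
move=> s1 s2 s3 s4 Up; rewrite /riemann sph_metric_split /sph_base /sph_sphere.
rewrite !sph_curvature // !sum4 /kulkarni_nomizu /sph_base /sph_sphere /sph_diag /=.
have Fn := F_neq0 Up.
by field.
Qed.

Lemma sph_coord_metric X (i : 'I_4) p :
  metric g (coord_vf i) X p = sph_diag i p * X p 0 i.
Proof.
rewrite diagonal_metricE (bigD1 i) //= big1 => [|j ji].
  by rewrite mxE !eqxx addr0 mulr1.
by rewrite mxE (negbTE ji) andbF mulr0 mul0r.
Qed.

Lemma sph_coord_ricci X (i : 'I_4) p : smooth_vf U X -> U p ->
  ricci nabla (coord_vf i) X p = sph_diag i p * X p 0 i *
    (if (i < 2)%N then sph_ricci_base (p 0 1) else sph_ricci_sphere (p 0 1)).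
Proof.
move=> sX Up; rewrite sph_ricci //; last exact: smooth_coord_vf.
rewrite /sph_base /sph_sphere /sph_diag.
by case: (ord4_cases i) => ->; rewrite !mxE -?val_eqE /=; ring.
Qed.

(** An Einstein factor would be both eigenvalues of the Ricci operator, as is seen
    on the [t] and [theta] coordinate fields. *)
Lemma sph_not_einstein p : U p -> sph_ricci_base (p 0 1) != sph_ricci_sphere (p 0 1) ->
  ~ einstein U g nabla.
Proof.
move=> Up /eqP lm [alpha E].
have sco l : smooth_vf U (@coord_vf R 3 l) by apply: smooth_coord_vf.
have {}E (i : 'I_4) : alpha p =
    if (i < 2)%N then sph_ricci_base (p 0 1) else sph_ricci_sphere (p 0 1).
  have di := sph_diag_neq0 i Up.
  apply: (mulfI di); move: (E _ _ (sco i) (sco i) p Up).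
  rewrite sph_coord_ricci // sph_coord_metric !mxE !eqxx !mulr1 => ->.
  exact: mulrC.
exact: lm (etrans (esym (E 0)) (E 2)).
Qed.

Variable J : vfield R 3 -> vfield R 3.
Hypothesis hJ : ricci_operator U g nabla J.

Lemma sph_ricci_operatorE X (i : 'I_4) p : smooth_vf U X -> U p ->
  J X p 0 i =
    (if (i < 2)%N then sph_ricci_base (p 0 1) else sph_ricci_sphere (p 0 1)) * X p 0 i.
Proof.
move=> sX Up; have di := sph_diag_neq0 i Up.
apply: (mulfI di); rewrite -sph_coord_metric (ricci_opP hJ) //.
  by rewrite sph_coord_ricci // mulrAC mulrA.
exact: smooth_coord_vf.
Qed.

Lemma sph_ricci_squared X Y p : smooth_vf U X -> smooth_vf U Y -> U p ->
  ricci2 nabla J X Y p =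
  sph_ricci_base (p 0 1) ^+ 2 * sph_base X Y p + sph_ricci_sphere (p 0 1) ^+ 2 * sph_sphere X Y p.
Proof.
move=> sX sY Up; rewrite /ricci2 sph_ricci //; last exact: (ricci_op_smooth hJ).
by rewrite /sph_base /sph_sphere !sph_ricci_operatorE //=; ring.
Qed.

Hypothesis F2_smooth : smooth_on U (fun p => F2 (p 0 1)).

Lemma sph_Kbase_smooth : smooth_on U (fun p => sph_Kbase (p 0 1)).
Proof.
by apply/(smooth_opp oU)/(smooth_mul oU) => //; apply: (smooth_cst oU).
Qed.
Lemma sph_Kmixed_smooth : smooth_on U (fun p => sph_Kmixed (p 0 1)).
Proof.
apply/(smooth_opp oU)/(smooth_mul oU) => //; apply: (smooth_inv oU).
  by move=> p Up; rewrite mulf_neq0 ?pnatr_eq0 // r_neq0.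
by apply: (smooth_mul oU); [apply: (smooth_cst oU)|apply: (smooth_coord oU)].
Qed.
Lemma sph_Ksphere_smooth : smooth_on U (fun p => sph_Ksphere (p 0 1)).
Proof.
apply: (smooth_mul oU).
  by apply: (smooth_sub oU) => //; apply: (smooth_cst oU).
apply: (smooth_inv oU); first by move=> p Up; rewrite expf_neq0 ?r_neq0.
exact/(smooth_exp oU)/(smooth_coord oU).
Qed.
Lemma sph_ricci_base_smooth : smooth_on U (fun p => sph_ricci_base (p 0 1)).
Proof.
apply: (smooth_add oU); first exact: sph_Kbase_smooth.
by apply: (smooth_mul oU); [apply: (smooth_cst oU)|apply: sph_Kmixed_smooth].
Qed.
Lemma sph_ricci_sphere_smooth : smooth_on U (fun p => sph_ricci_sphere (p 0 1)).
Proof.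
apply: (smooth_add oU); last exact: sph_Ksphere_smooth.
by apply: (smooth_mul oU); [apply: (smooth_cst oU)|apply: sph_Kmixed_smooth].
Qed.

(** The Ricci operator is annihilated by the polynomial with its two eigenvalues as
    roots. *)
Lemma sph_einstein_level2 : einstein_level2 U g nabla J.
Proof.
exists (fun=> 1), (fun p => - (sph_ricci_base (p 0 1) + sph_ricci_sphere (p 0 1))),
  (fun p => sph_ricci_base (p 0 1) * sph_ricci_sphere (p 0 1)).
have [sl sm] := (sph_ricci_base_smooth, sph_ricci_sphere_smooth).
split.
- exact: (smooth_cst oU).
- by apply/(smooth_opp oU)/(smooth_add oU).
- exact: (smooth_mul oU).
- by move=> p _; rewrite oner_eq0.
move=> X Y sX sY p Up.
by rewrite sph_ricci_squared // sph_ricci // sph_metric_split; ring.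
Qed.

(** When the eigenvalues [l] and [m] of the Ricci operator differ, the two blocks of
    the metric are [(S - m g) / (l - m)] and [(l g - S) / (l - m)]. *)
Lemma sph_roter_type :
  (forall p, U p -> sph_ricci_base (p 0 1) != sph_ricci_sphere (p 0 1)) ->
  roter_type U g nabla.
Proof.
move=> lm.
have [sl sm] := (sph_ricci_base_smooth, sph_ricci_sphere_smooth).
have [s1 s2] := (sph_Kbase_smooth, sph_Kmixed_smooth); have s3 := sph_Ksphere_smooth.
have lm0 p : U p -> sph_ricci_base (p 0 1) - sph_ricci_sphere (p 0 1) != 0.
  by move=> Up; rewrite subr_eq0 lm.
have sD : smooth_on U (fun p => (sph_ricci_base (p 0 1) - sph_ricci_sphere (p 0 1)) ^- 2).
  apply: (smooth_inv oU); first by move=> p Up; rewrite expf_neq0 ?lm0.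
  exact/(smooth_exp oU)/(smooth_sub oU).
have scst c := smooth_cst oU (c : R).
(* The coefficients are those of [g /\ g], [g /\ S] and [S /\ S] after these two
   expressions have been substituted into [sph_riemann]. *)
exists (fun p => let l := sph_ricci_base (p 0 1) in let m := sph_ricci_sphere (p 0 1) in
    (2^-1 * sph_Kbase (p 0 1) * m ^+ 2 - sph_Kmixed (p 0 1) * (l * m)
     + 2^-1 * sph_Ksphere (p 0 1) * l ^+ 2) * (l - m) ^- 2),
  (fun p => let l := sph_ricci_base (p 0 1) in let m := sph_ricci_sphere (p 0 1) in
    (sph_Kmixed (p 0 1) * (l + m) - sph_Kbase (p 0 1) * m - sph_Ksphere (p 0 1) * l)
     * (l - m) ^- 2),
  (fun p => let l := sph_ricci_base (p 0 1) in let m := sph_ricci_sphere (p 0 1) in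
    (2^-1 * sph_Kbase (p 0 1) - sph_Kmixed (p 0 1) + 2^-1 * sph_Ksphere (p 0 1))
     * (l - m) ^- 2).
split.
- apply: (smooth_mul oU) => //; apply: (smooth_add oU); first apply: (smooth_sub oU).
  + by apply: (smooth_mul oU); [apply: (smooth_mul oU)|apply: (smooth_exp oU)].
  + by apply: (smooth_mul oU) => //; apply: (smooth_mul oU).
  + by apply: (smooth_mul oU); [apply: (smooth_mul oU)|apply: (smooth_exp oU)].
- apply: (smooth_mul oU) => //; apply: (smooth_sub oU); first apply: (smooth_sub oU);
    apply: (smooth_mul oU) => //.
  exact: (smooth_add oU).
- apply: (smooth_mul oU) => //; apply: (smooth_add oU); first apply: (smooth_sub oU) => //;
    exact: (smooth_mul oU).
move=> X1 X2 X3 X4 sX1 sX2 sX3 sX4 p Up /=.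
rewrite sph_riemann // /kulkarni_nomizu !sph_metric_split !sph_ricci //.
have D := lm0 p Up.
by field.
Qed.
End StaticSpherical.

(** * The Bardeen profile *)

Section Bardeen.
Variables (R : realType) (M e : R).
Hypothesis he : e != 0.
Local Notation U := (bardeen_dom M e).
Local Notation F := (bardeen_f M e).
Local Notation w := (rho1 e).

(** The first two derivatives of [F], reduced with [rho1^2 = e^2 + r^2]. *)
Definition bardeen_f1 (r : R) : R :=
  - 2 * M * r * (2 * e ^+ 2 - r ^+ 2) * w r ^- 5.
Definition bardeen_f2 (r : R) : R :=
  - 2 * M * (2 * (e ^+ 2) ^+ 2 - 11 * e ^+ 2 * r ^+ 2 + 2 * r ^+ 4) * w r ^- 7.

Lemma rho1_neq0 r : w r != 0.
Proof. by rewrite gt_eqF // sqrtr_gt0 rho1_gt0. Qed.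

(** Oriented to eliminate [e]: the identities below hold in [r] and [rho1] as
    independent variables. *)
Lemma rho1_sqr r : e ^+ 2 = w r ^+ 2 - r ^+ 2.
Proof. by rewrite /rho1 sqr_sqrtr ?addrK // ltW // rho1_gt0. Qed.

Lemma rho1_der (r : R) : is_derive r 1 w (r / w r).
Proof.
have d2 : is_derive r 1 (fun t : R => e ^+ 2 + t ^+ 2) (2 * r).
  apply: is_derive_eq (rderive_add (rderive_cst r (e ^+ 2)) (rderive_exp 2 (rderive_id r))) _.
  by rewrite /= expr1 mulr1 add0r.
have := @is_derive1_comp _ Num.sqrt (fun t => e ^+ 2 + t ^+ 2) r _ _
  (is_derive1_sqrt (rho1_gt0 he r)) d2.
move=> D; apply: is_derive_eq D _.
by rewrite -/(w r); field; rewrite rho1_neq0.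
Qed.

Lemma rho1V_der k (r : R) : is_derive r 1 (fun t => w t ^- k.+1)
  (- (k.+1%:R * r * w r ^- k.+3)).
Proof.
have wn := rho1_neq0 r; have wk : w r ^+ k != 0 by rewrite expf_neq0.
apply: is_derive_eq (@rderive_inv _ r (fun t => w t ^+ k.+1) _ (expf_neq0 _ wn)
  (rderive_exp k.+1 (rho1_der r))) _.
rewrite /= !exprS.
move: (w r ^+ k) wk => x wk.
by field; rewrite wn wk.
Qed.

Lemma bardeen_f_der (r : R) : is_derive r 1 F (bardeen_f1 r).
Proof.
have D := rderive_add (rderive_cst r 1) (rderive_opp (rderive_mul
  (rderive_mul (rderive_cst r (2 * M)) (rderive_exp 2 (rderive_id r))) (rho1V_der 2 r))).
apply: is_derive_eq D _.
have wn := rho1_neq0 r.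
rewrite /bardeen_f1 (rho1_sqr r) /=; move: (w r) wn => z zn.
by field.
Qed.

Lemma bardeen_f1_der (r : R) : is_derive r 1 bardeen_f1 (bardeen_f2 r).
Proof.
have D := rderive_mul (rderive_mul (rderive_mul (rderive_cst r (- 2 * M)) (rderive_id r))
  (rderive_add (rderive_cst r (2 * e ^+ 2)) (rderive_opp (rderive_exp 2 (rderive_id r)))))
  (rho1V_der 4 r).
apply: is_derive_eq D _.
have wn := rho1_neq0 r.
rewrite /bardeen_f2 (rho1_sqr r) /=; move: (w r) wn => z zn.
by field.
Qed.

Let oU : open U := @open_bardeen R M e he.
Let sr : smooth_on U (fun p => p 0 1). Proof. exact: (smooth_coord oU). Qed.
Let sw : smooth_on U (fun p => w (p 0 1)).
Proof.
apply: (smooth_sqrt oU); first by move=> p _; apply: rho1_gt0.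
by apply: (smooth_add oU); [apply: (smooth_cst oU)|apply: (smooth_exp oU)].
Qed.
Let swV k : smooth_on U (fun p => w (p 0 1) ^- k).
Proof.
apply: (smooth_inv oU); last exact: (smooth_exp oU).
by move=> p _; rewrite expf_neq0 // rho1_neq0.
Qed.
Let sc c : smooth_on U (fun=> c). Proof. exact: (smooth_cst oU). Qed.
Let sX k : smooth_on U (fun p => p 0 1 ^+ k).
Proof. exact: (smooth_exp oU). Qed.

Lemma bardeen_f_smooth : smooth_on U (fun p => F (p 0 1)).
Proof.
apply: (smooth_sub oU) => //; apply: (smooth_mul oU) => //.
exact: (smooth_mul oU).
Qed.

Lemma bardeen_f1_smooth : smooth_on U (fun p => bardeen_f1 (p 0 1)).
Proof.
apply: (smooth_mul oU) => //; apply: (smooth_mul oU); last exact: (smooth_sub oU).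
exact: (smooth_mul oU).
Qed.

Lemma bardeen_f2_smooth : smooth_on U (fun p => bardeen_f2 (p 0 1)).
Proof.
apply: (smooth_mul oU) => //; apply: (smooth_mul oU) => //.
apply: (smooth_add oU); last exact: (smooth_mul oU).
by apply: (smooth_sub oU) => //; apply: (smooth_mul oU).
Qed.

(** The terms in [Kmixed] drop out, and the numerator of [Kbase - Ksphere] is, up to
    the factor [M], [2 e^4 - 11 e^2 r^2 + 2 r^4 - 2 (e^2 + r^2)^2]. *)
Lemma bardeen_ricci_gap r : r != 0 ->
  sph_ricci_base bardeen_f1 bardeen_f2 r - sph_ricci_sphere F bardeen_f1 r =
  - 15 * M * e ^+ 2 * r ^+ 2 * w r ^- 7.
Proof.
move=> rn; have wn := rho1_neq0 r.
rewrite /sph_ricci_base /sph_ricci_sphere /sph_Kbase /sph_Ksphere.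
rewrite /bardeen_f2 /bardeen_f (rho1_sqr r).
move: (w r) wn (sph_Kmixed _ _) => z zn k; by field; rewrite zn rn.
Qed.

(** A metric on an empty domain would be Einstein. For a point, any [r > 2 |M|]
    will do, since then [rho1^3 >= r^3 > 2 M r^2]. *)
Lemma bardeen_dom_nonempty : exists p, U p.
Proof.
pose r := 2 * `|M| + 1 : R.
have r0 : 0 < r by rewrite ltr_wpDl // mulr_ge0.
exists (\row_i [:: 0; r; pi / 2; 0]`_i); rewrite /bardeen_dom /= !mxE /=.
have p0 := pi_gt0 R.
split=> //; first by apply/andP; split; lra.
rewrite gt_eqF //.
have wr : r <= w r.
  by rewrite /rho1 -{1}(ger0_norm (ltW r0)) -sqrtr_sqr ler_wsqrtr // lerDr sqr_ge0.
apply: (@lt_le_trans _ _ (r ^+ 3)); last by rewrite ler_pXn2r // nnegrE ltW // (lt_le_trans r0).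
rewrite (exprS r 2) ltr_pM2r ?exprn_gt0 //.
have := ler_norm M; rewrite /r; lra.
Qed.
End Bardeen.

Theorem proposition3p1 (R : realType) (M e : R) (hM : M != 0) (he : e != 0)
    (nabla : vfield R 3 -> vfield R 3 -> vfield R 3)
    (J : vfield R 3 -> vfield R 3)
    (hnabla : levi_civita (bardeen_dom M e) (bardeen_metric M e) nabla)
    (hJ : ricci_operator (bardeen_dom M e) (bardeen_metric M e) nabla J) :
  ~ einstein (bardeen_dom M e) (bardeen_metric M e) nabla /\
  einstein_level2 (bardeen_dom M e) (bardeen_metric M e) nabla J /\
  roter_type (bardeen_dom M e) (bardeen_metric M e) nabla.
Proof.
set U := bardeen_dom M e in hnabla hJ *.
have oU : open U := @open_bardeen R M e he.
have rn p : U p -> p 0 1 != 0 by case=> r0 _ _; rewrite gt_eqF.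
have sn p : U p -> sin (p 0 2) != 0 by case=> _ ? _; rewrite gt_eqF // sin_gt0_pi.
have Fn p : U p -> bardeen_f M e (p 0 1) != 0 by apply: bardeen_f_neq0.
have dF p : U p -> is_derive (p 0 1) 1 (bardeen_f M e) (bardeen_f1 M e (p 0 1)).
  by move=> _; apply: bardeen_f_der.
have dF1 p : U p ->
    is_derive (p 0 1) 1 (bardeen_f1 M e) (bardeen_f2 M e (p 0 1)).
  by move=> _; apply: bardeen_f1_der.
have sF := bardeen_f_smooth M he.
have sF1 := bardeen_f1_smooth M he.
have sF2 := bardeen_f2_smooth M he.
have lm p : U p -> sph_ricci_base (bardeen_f1 M e) (bardeen_f2 M e) (p 0 1) !=
    sph_ricci_sphere (bardeen_f M e) (bardeen_f1 M e) (p 0 1).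
  move=> Up; rewrite -subr_eq0 bardeen_ricci_gap ?rn //.
  by rewrite !mulf_neq0 ?oppr_eq0 ?pnatr_eq0 ?invr_eq0 ?expf_neq0 ?rho1_neq0 ?rn.
have gE : bardeen_metric M e = diagonal_metric (sph_diag (bardeen_f M e)) by [].
rewrite gE in hnabla hJ *.
split; last split.
- have [p Up] := bardeen_dom_nonempty M e.
  exact: (sph_not_einstein oU rn sn Fn dF dF1 sF sF1 hnabla Up (lm p Up)).
- exact: (sph_einstein_level2 oU rn sn Fn dF dF1 sF sF1 hnabla hJ sF2).
- exact: (sph_roter_type oU rn sn Fn dF dF1 sF sF1 hnabla sF2 lm).
Qed.
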